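(* The monodromy theorem holds for free analytic functions on any open connected free set $\mathcal{D}$. That is, the statement of the monodromy theorem holds for free analytic functions with the open connected free set $\mathcal{D}$ in place of the simply connected domain: a free analytic function on some ball $B$ in $\mathcal{D}$ analytically continues to $\mathcal{D}$ if and only if it analytically continues along each path in $\mathcal{D}$.
   Context: For a topological vector space $R$ over $\mathbb{C}$, the matrix universe over $R$ is $\mathcal{M}(R)=\bigcup_{n\ge1}M_n(\mathbb{C})\otimes R$. A free set $D\subseteq\mathcal{M}(R)$ is a set closed under direct sums ($X,Y\in D\Rightarrow X\oplus Y\in D$) and unitary conjugation ($X\in D$, $V$ unitary $\Rightarrow V^*XV\in D$). Write $D_n=D\cap (M_n(\mathbb{C})\otimes R)$. A free set $D$ is open if each $D_n$ is open, and connected if each $D_n$ is path connected. A (real) free function $f:D\to\mathcal{M}(R_2)$, with $D\subseteq\mathcal{M}(R_1)$, satisfies $f(D_n)\subseteq M_n(\mathbb{C})\otimes R_2$, $f(X\oplus Y)=f(X)\oplus f(Y)$, and $f(V^*XV)=V^*f(X)V$ for $V$ unitary. It is analytic if each restriction $f_n=f|_{D_n}$ is analytic. The (classical) monodromy theorem states that a complex analytic function (perhaps in several variables) on some ball $B$ analytically continues to a simply connected domain $D$ containing $B$ if and only if it analytically continues along each path in $D$. *)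

(* Defs.v *)
From HB Require Import structures.
From mathcomp Require Import all_boot all_order all_algebra.
From mathcomp Require Import complex.
From mathcomp Require Import all_classical all_reals all_analysis.

Set Implicit Arguments.
Unset Strict Implicit.
Unset Printing Implicit Defensive.

Import Order.TTheory GRing.Theory Num.Theory.
Import numFieldTopology.Exports.

Local Open Scope classical_set_scope.
Local Open Scope ring_scope.

Section Analytic.
Variables (C : numFieldType) (E F : topologicalLmodType C).

Definition row_set k (v : 'rV[E]_k) (i : 'I_k) (x : E) : 'rV[E]_k :=
  \row_j (if j == i then x else v ord0 j).

Definition multilinear k (L : 'rV[E]_k -> F) : Prop :=
  forall (i : 'I_k) (v : 'rV[E]_k) (a : C) (x y : E),
    L (row_set v i (a *: x + y)) =
      a *: L (row_set v i x) + L (row_set v i y).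

Definition cont_homog_poly (k : nat) (P : E -> F) : Prop :=
  exists L : 'rV[E]_k -> F,
    [/\ multilinear L, continuous L & forall h, P h = L (const_mx h)].

(* [f] is continuous at [a] and is, near [a], the sum of its Taylor series.
   The Peano estimate along complex lines says that the partial sums are the
   Taylor polynomials of [f] at [a]; it follows from the convergence of the
   series when [F] is locally convex, but not for a general topological vector
   space, where it is what makes the expansion unique. *)
Definition analytic_at (f : E -> F) (a : E) : Prop :=
  {for a, continuous f} /\
  exists P : nat -> E -> F,
    [/\ forall k, cont_homog_poly k (P k),
        \forall h \near (0 : E), series (fun k => P k h) @ \oo --> f (a + h) &
        forall (m : nat) (h : E),
          (t ^- m *: (f (a + t *: h) - \sum_(k < m.+1) t ^+ k *: P k h))
            @[t --> (0 : C^o)^'] --> (0 : F)].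

Definition analytic_on (U : set E) (f : E -> F) : Prop :=
  forall a, U a -> analytic_at f a.

End Analytic.

(* The space M_n(C) (x) E, as n x n matrices over E, with entrywise operations
   and the product topology. It is an alias because 'M[E]_n is canonically a
   module over its entries only. *)
Definition mxlevel (C : numFieldType) (E : topologicalLmodType C) (n : nat) :=
  'M[E]_n.

Section MxLevel.
Variables (C : numFieldType) (E : topologicalLmodType C) (n : nat).

HB.instance Definition _ := GRing.Zmodule.on (mxlevel E n).
HB.instance Definition _ := Topological.on (mxlevel E n).

Let scale (a : C) (X : mxlevel E n) : mxlevel E n := map_mx ( *:%R a) X.

Let scaleA a b X : scale a (scale b X) = scale (a * b) X.
Proof. by apply/matrixP => i j; rewrite !mxE scalerA. Qed.

Let scale1 : left_id 1 scale.
Proof. by move=> X; apply/matrixP => i j; rewrite !mxE scale1r. Qed.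

Let scaleDr : right_distributive scale +%R.
Proof. by move=> a X Y; apply/matrixP => i j; rewrite !mxE scalerDr. Qed.

Let scaleDl X : {morph scale^~ X : a b / a + b}.
Proof. by move=> a b; apply/matrixP => i j; rewrite !mxE scalerDl. Qed.

HB.instance Definition _ :=
  GRing.Zmodule_isLmodule.Build C (mxlevel E n) scaleA scale1 scaleDr scaleDl.

Let add_continuous : continuous (fun x : mxlevel E n * mxlevel E n => x.1 + x.2).
Proof.
move=> [X Y] /= A [P XYP PA].
have /= PE i j := @add_continuous E (X i j, Y i j) (P i j).
have {}PE i j : exists Q : set E * set E, [/\ nbhs (X i j) Q.1,
    nbhs (Y i j) Q.2 & forall x y, Q.1 x -> Q.2 y -> P i j (x + y)].
  have := XYP i j; rewrite mxE => /PE [[Q1 Q2] /= [? ?] QP].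
  by exists (Q1, Q2); split=> // x y ? ?; exact: (QP (x, y)).
pose Q i j := sval (cid (PE i j)).
have QE i j := svalP (cid (PE i j)).
exists ([set M : 'M[E]_n | forall i j, (Q i j).1 (M i j)],
        [set M : 'M[E]_n | forall i j, (Q i j).2 (M i j)]) => /=.
  split; [exists (fun i j => (Q i j).1) | exists (fun i j => (Q i j).2)] => //.
    by move=> i j; have [] := QE i j.
  by move=> i j; have [] := QE i j.
move=> [X' Y'] /= [X'Q Y'Q]; apply: PA => i j; rewrite mxE.
by have [_ _] := QE i j; apply; [exact: X'Q|exact: Y'Q].
Qed.

HB.instance Definition _ :=
  PreTopologicalNmodule_isTopologicalNmodule.Build (mxlevel E n) add_continuous.

Let scale_continuous : continuous (fun z : C^o * mxlevel E n => z.1 *: z.2).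
Proof.
move=> [a X] /= A [P XP PA].
have /= PE i j := @scale_continuous C E (a, X i j) (P i j).
have {}PE i j : exists Q : set C^o * set E, [/\ nbhs (a : C^o) Q.1,
    nbhs (X i j) Q.2 & forall b x, Q.1 b -> Q.2 x -> P i j (b *: x)].
  have := XP i j; rewrite mxE => /PE [[Q1 Q2] /= [? ?] QP].
  by exists (Q1, Q2); split=> // b x ? ?; exact: (QP (b, x)).
pose Q i j := sval (cid (PE i j)).
have QE i j := svalP (cid (PE i j)).
exists ([set b : C^o | forall i j, (Q i j).1 b],
        [set M : 'M[E]_n | forall i j, (Q i j).2 (M i j)]) => /=.
  split; last by exists (fun i j => (Q i j).2) => // i j; have [] := QE i j.
  have FF : Filter (nbhs (a : C^o)) by exact: nbhs_filter.
  apply: (filter_forall FF) => i; apply: (filter_forall FF) => j.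
  by have [] := QE i j.
move=> [b Y] /= [bQ YQ]; apply: PA => i j; rewrite mxE.
by have [_ _] := QE i j; apply; [exact: bQ|exact: YQ].
Qed.

HB.instance Definition _ :=
  TopologicalNmodule_isTopologicalLmodule.Build C (mxlevel E n) scale_continuous.

End MxLevel.

Section FreeSets.
Variable C : numClosedFieldType.
Implicit Types E F : topologicalLmodType C.

Definition dsum E n m (X : mxlevel E n) (Y : mxlevel E m) : mxlevel E (n + m) :=
  block_mx X 0 0 Y.

(* V^* X V, where V acts on the entries of X by scalar multiplication *)
Definition uconj E n (V : 'M[C]_n) (X : mxlevel E n) : mxlevel E n :=
  \matrix_(i, j) \sum_k \sum_l ((V k i)^* * V l j) *: X k l.

(* A subset of the matrix universe is given by its levels, n >= 1; hence the
   requirement that the spurious level 0 be empty. *)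
Definition free_set E (D : forall n, set (mxlevel E n)) : Prop :=
  [/\ D 0%N = set0,
      forall n m X Y, D n X -> D m Y -> D (n + m)%N (dsum X Y) &
      forall n (V : 'M[C]_n) X, V \is unitarymx -> D n X -> D n (uconj V X)].

Definition free_open E (D : forall n, set (mxlevel E n)) : Prop :=
  forall n, open (D n).

Definition free_function E F (D : forall n, set (mxlevel E n))
    (f : forall n, mxlevel E n -> mxlevel F n) : Prop :=
  (forall n m X Y, D n X -> D m Y ->
     f (n + m)%N (dsum X Y) = dsum (f n X) (f m Y)) /\
  (forall n (V : 'M[C]_n) X, V \is unitarymx -> D n X ->
     f n (uconj V X) = uconj V (f n X)).

Definition free_analytic E F (D : forall n, set (mxlevel E n))
    (f : forall n, mxlevel E n -> mxlevel F n) : Prop :=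
  free_function D f /\ forall n, analytic_on (D n) (f n).

End FreeSets.

Section Paths.
Variables (R : realType).

Definition path_in (T : topologicalType) (A : set T) (gamma : R -> T) : Prop :=
  {within `[0, 1], continuous gamma} /\ forall t, t \in `[0, 1] -> A (gamma t).

Definition path_connected (T : topologicalType) (A : set T) : Prop :=
  forall x y, A x -> A y ->
    exists gamma : R -> T, [/\ path_in A gamma, gamma 0 = x & gamma 1 = y].

Definition free_connected (E : topologicalLmodType R[i])
    (D : forall n, set (mxlevel E n)) : Prop :=
  forall n, path_connected (D n).

(* Analytic continuation along [gamma] of the germ of [f] at [gamma 0], by a
   family of function elements [(U t, g t)]. *)
Definition continues_along (E F : topologicalLmodType R[i])
    (f : E -> F) (gamma : R -> E) : Prop :=
  exists (U : R -> set E) (g : R -> E -> F),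
    [/\ forall t, t \in `[0, 1] ->
          [/\ open (U t), U t (gamma t) & analytic_on (U t) (g t)],
        \forall x \near gamma 0, g 0 x = f x &
        forall t, t \in `[0, 1] ->
          exists2 e, 0 < e & forall s, s \in `[0, 1] -> `|s - t| < e ->
            U t (gamma s) /\ \forall x \near gamma s, g s x = g t x].

End Paths.

(* Main.v *)
(* Two continuations along the same path agree by the identity theorem, which
   only involves segments and the Peano estimates, so that no local convexity is
   needed.  Applied to gamma (+) gamma', it shows that the continuation of f
   along a direct sum of two paths ends at the direct sum of the end values.

   Let gamma end at X with end value y, and let the orthogonal projection Q
   commute with X.  The unitaries V = 1 + (w - 1) Q, |w| = 1, fix X, though not
   the path.  For w near 1, however, Z |-> h(V^* Z V) and Z |-> V^* h(Z) V are
   both continuations along gamma, equal at the start since f is free; hence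
   they agree at X, and Q commutes with y.

   If now y and y' are end values at X and X', and T is a partial isometry with
   X T = T X' and T^* X = X' T^*, then the projection
   1/2 [T T^*, - T; - T^*, T^* T] commutes with X (+) X', hence with y (+) y',
   and therefore y T = T y'.  The choice T = 1 says that the end value does not
   depend on the path; T unitary, or T the inclusion of a summand, says that the
   end values form a free function extending f. *)

Require Import Defs.
From mathcomp Require Import zify ring lra.
From mathcomp Require Import all_boot all_order all_algebra.
From mathcomp Require Import complex.
From mathcomp Require Import all_classical all_reals all_analysis.

Set Implicit Arguments.
Unset Strict Implicit.
Unset Printing Implicit Defensive.

Import Order.TTheory GRing.Theory Num.Theory.
Import numFieldTopology.Exports.

Local Open Scope classical_set_scope.
Local Open Scope ring_scope.
Local Open Scope complex_scope.

(** * Limits in topological modules and real induction *)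

Section TopologicalLmodule.
Variables (C : numFieldType) (E : topologicalLmodType C).

Lemma tvs_cvgD (T : Type) (F : set_system T) {FF : Filter F} (f g : T -> E) (a b : E) :
  f @ F --> a -> g @ F --> b -> (fun x => f x + g x) @ F --> a + b.
Proof.
by move=> fa gb; exact: (cvg_comp2 fa gb (@add_continuous E (a, b))).
Qed.

Lemma tvs_cvgN (T : Type) (F : set_system T) {FF : Filter F} (f : T -> E) (a : E) :
  f @ F --> a -> (fun x => - f x) @ F --> - a.
Proof. by move=> fa; apply: (cvg_comp _ _ fa); exact: opp_continuous. Qed.

Lemma tvs_cvgZ (T : Type) (F : set_system T) {FF : Filter F}
    (k : T -> C^o) (f : T -> E) (c : C^o) (a : E) :
  k @ F --> c -> f @ F --> a -> (fun x => k x *: f x) @ F --> c *: a.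
Proof.
by move=> kc fa; exact: (cvg_comp2 kc fa (@scale_continuous C E (c, a))).
Qed.

Lemma tvs_cvg_sum (T : Type) (F : set_system T) {FF : Filter F} (I : Type)
    (r : seq I) (f : I -> T -> E) (a : I -> E) :
  (forall i, f i @ F --> a i) ->
  (fun x => \sum_(i <- r) f i x) @ F --> \sum_(i <- r) a i.
Proof.
move=> fa; elim: r => [|i r IH].
  rewrite big_nil; under eq_fun do rewrite big_nil; exact: cvg_cst.
rewrite big_cons; under eq_fun do rewrite big_cons; exact: tvs_cvgD.
Qed.

Lemma cvg_line (a h : E) (c : C^o) :
  (fun t : C^o => a + t *: h) @ c --> a + c *: h.
Proof.
have FF : Filter (nbhs c) by exact: nbhs_filter.
apply: (@tvs_cvgD _ _ FF (fun=> a) (fun t => t *: h)); first exact: cvg_cst.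
by apply: (@tvs_cvgZ _ _ FF id (fun=> h)); [exact: cvg_id|exact: cvg_cst].
Qed.

End TopologicalLmodule.
Arguments tvs_cvgD {C E T F FF f g a b} _ _.
Arguments tvs_cvgZ {C E T F FF k f c a} _ _.
Arguments tvs_cvgN {C E T F FF f a} _.
Arguments tvs_cvg_sum {C E T F FF I r f a} _.
Arguments cvg_line {C E} a h c.

Section MatrixLimits.
Variables (T : topologicalType) (m n : nat).

Lemma cvg_mx (I : Type) (F : set_system I) {FF : Filter F}
    (f : I -> 'M[T]_(m, n)) (A : 'M[T]_(m, n)) :
  (forall i j, (fun x => f x i j) @ F --> A i j) -> f @ F --> A.
Proof.
move=> fA U [P AP PU]; rewrite /nbhs /=.
have : \forall x \near F, forall i j, P i j (f x i j).
  by apply: filter_forall => i; apply: filter_forall => j; exact/fA/AP.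
by apply: filterS => x Px; exact/PU.
Qed.

Lemma mx_entry_continuous i j : continuous (fun A : 'M[T]_(m, n) => A i j).
Proof.
move=> A U AU.
(* The box constrains only the entry at [(i, j)]; every other factor is the whole space. *)
exists (fun i' j' => [set x | i' = i /\ j' = j -> U x]) => /=.
  move=> i' j'; have [[-> ->]|ne] := pselect (i' = i /\ j' = j).
    by apply: filterS AU => x Ux _.
  by apply: filterS (filterT : nbhs (A i' j') setT) => x _ /ne.
by move=> M /(_ i j); exact.
Qed.

Lemma mx_hausdorff : hausdorff_space T -> hausdorff_space 'M[T]_(m, n).
Proof.
move=> hT A B AB; apply/matrixP => i j; apply: hT => U V AU BV.
have [M [/= UM VM]] := AB _ _ (mx_entry_continuous AU) (mx_entry_continuous BV).
by exists (M i j).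
Qed.

End MatrixLimits.
Arguments cvg_mx {T m n I F FF f A} _.

Section Complex.
Variable R : realType.
Local Notation C := R[i].

Lemma real_complex_continuous : continuous (fun t : R => t%:C : C^o).
Proof.
move=> t; apply/cvgrPdist_lt => e e0.
(* In the order of [R[i]] a positive element is real, so the estimate can be made in [R]. *)
have [e' eE] : exists r : R, e = r%:C.
  by exists (complex.Re e); apply/eqP; rewrite RRe_real // gtr0_real.
rewrite {}eE in e0 *; rewrite ltcR in e0.
near=> s; rewrite -rmorphB normc_def /= expr0n /= addr0 sqrtr_sqr ltcR.
by near: s; apply: cvgr_dist_lt.
Unshelve. all: by end_near. Qed.

(** Turns a Peano estimate, a limit at the punctured complex origin, into a limit along the negative
    reals, with the parameter rescaled by [a]. *)
Lemma cvg_real_complex_dnbhs0 (a : R) : a != 0 ->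
  (fun t => (t * a)%:C : C^o) @ (0 : R)^'- --> (0 : C^o)^'.
Proof.
move=> a0 U; rewrite /dnbhs /within /= => U0.
have : \forall t \near (0 : R), (fun u : C => u != 0 -> U u) (t * a)%:C.
  have c0 : (fun t : R => (t * a)%:C : C^o) @ (0 : R) --> (0 : C^o).
    have h : (fun t : R => t * a) @ (0 : R) --> (0 * a : R).
      by apply: cvgM; [exact: cvg_id|exact: cvg_cst].
    by have := cvg_comp _ _ h (@real_complex_continuous _); rewrite mul0r.
  exact: c0 U0.
move=> H; rewrite /nbhs /= /at_left /within /=.
apply: filterS H => t Ut t0; apply: Ut.
by rewrite -[0]/((0 : R)%:C) (inj_eq (@complexI _)) mulf_neq0 // lt_eqF.
Qed.

End Complex.

Section RealInduction.
Variable R : realType.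

(** Let m be the supremum of the t such that [P] holds on [0, t]. The last hypothesis gives [P m],
    and the other one would push the interval beyond m if m < 1. *)
Lemma real_induction (P : R -> Prop) : P 0 ->
  (forall t, 0 <= t < 1 -> (forall s, 0 <= s <= t -> P s) ->
     exists2 e, 0 < e & forall s, t < s < t + e -> s <= 1 -> P s) ->
  (forall t, 0 < t <= 1 -> (forall s, 0 <= s < t -> P s) -> P t) ->
  forall t, 0 <= t <= 1 -> P t.
Proof.
move=> P0 Pright Pleft.
pose A := [set t : R | 0 <= t <= 1 /\ forall s, 0 <= s <= t -> P s].
have A0 : A 0.
  by split=> [|s]; rewrite ?lexx ?ler01// -eq_le => /eqP <-.
have Asup : has_sup A.
  by split; [exists 0|exists 1 => t [/andP[]]].
pose m := sup A.
have m0 : 0 <= m by apply: sup_upper_bound.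
have m1 : m <= 1 by apply: ge_sup; [exists 0|move=> t [/andP[]]].
have Pm s : 0 <= s < m -> P s.
  move=> /andP[s0 sm].
  have [t [_ At] st] := sup_adherent (eps := m - s) (etrans (subr_gt0 _ _) sm) Asup.
  apply: At; rewrite s0 /= ltW //; move: st; rewrite -/m; congr (_ < _).
  by rewrite subKr.
have Pmm : P m.
  by have [->//|mn0] := eqVneq m 0; apply: Pleft => //; rewrite lt_def mn0 m0.
have Pmle s : 0 <= s <= m -> P s.
  by move=> /andP[s0]; rewrite le_eqVlt => /predU1P[->//|sm]; apply: Pm; rewrite s0.
have m1E : m = 1.
  apply/eqP; rewrite eq_le m1 leNgt; apply/negP => mlt.
  have [e e0 Pe] := Pright m (introT andP (conj m0 mlt)) Pmle.
  pose t := Num.min 1 (m + e / 2).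
  have mt : m < t by rewrite lt_min mlt ltrDl divr_gt0.
  suff : A t by move=> /(sup_upper_bound Asup); rewrite leNgt mt.
  split=> [|s /andP[s0 st]]; first by rewrite (le_trans m0 (ltW mt)) ge_min lexx.
  have [sm|ms] := leP s m; first by apply: Pmle; rewrite s0.
  move: st; rewrite le_min => /andP[s1 sme]; apply: Pe => //.
  by rewrite ms (le_lt_trans sme)// ltrD2l ltr_pdivrMr// ltr_pMr// ltr1n.
by rewrite -m1E.
Qed.

End RealInduction.

(** * Analytic functions *)

Section ContinuousLinear.
Variable C : numFieldType.
Implicit Types E F G : topologicalLmodType C.

Definition cont_linear E F (L : E -> F) := linear L /\ continuous L.

Lemma cont_linearD E F (L : E -> F) x y : cont_linear L -> L (x + y) = L x + L y.
Proof. by move=> [lL _]; have := lL 1 x y; rewrite !scale1r. Qed.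

Lemma cont_linear0 E F (L : E -> F) : cont_linear L -> L 0 = 0.
Proof.
by move=> cL; apply: (addrI (L 0)); rewrite -(cont_linearD _ _ cL) !addr0.
Qed.

Lemma cont_linearZ E F (L : E -> F) a x : cont_linear L -> L (a *: x) = a *: L x.
Proof.
move=> cL; have [lL _] := cL.
by have := lL a x 0; rewrite (cont_linear0 cL) !addr0.
Qed.

Lemma cont_linearB E F (L : E -> F) x y : cont_linear L -> L (x - y) = L x - L y.
Proof.
by move=> cL; rewrite (cont_linearD _ _ cL) -scaleN1r (cont_linearZ _ _ cL) scaleN1r.
Qed.

Lemma cont_linear_sum E F (L : E -> F) I (r : seq I) (P : pred I) (f : I -> E) :
  cont_linear L -> L (\sum_(i <- r | P i) f i) = \sum_(i <- r | P i) L (f i).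
Proof.
move=> cL; apply: (big_morph L) => [x y|]; first exact: cont_linearD.
exact: cont_linear0.
Qed.

Lemma cont_linear_id E : cont_linear (@id E).
Proof. by split=> // x; exact: cvg_id. Qed.

Lemma cont_linear_comp E F G (L : E -> F) (M : F -> G) :
  cont_linear L -> cont_linear M -> cont_linear (M \o L).
Proof.
move=> [lL cL] [lM cM]; split=> [a x y|x] /=; first by rewrite lL lM.
by apply: continuous_comp; [exact: cL|exact: cM].
Qed.

Lemma cont_linear_add E F (L M : E -> F) :
  cont_linear L -> cont_linear M -> cont_linear (fun x => L x + M x).
Proof.
move=> [lL cL] [lM cM]; split=> [a x y|x].
  by rewrite lL lM scalerDr addrACA.
by apply: tvs_cvgD; [exact: cL|exact: cM].
Qed.

Lemma cont_linear_scale E (a : C) : cont_linear (fun x : E => a *: x).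
Proof.
split=> [b x y|x]; first by rewrite scalerDr !scalerA mulrC.
by apply: (@tvs_cvgZ _ _ _ _ _ (fun=> a)); [exact: cvg_cst|exact: cvg_id].
Qed.

End ContinuousLinear.

Section AnalyticAt.
Variable C : numFieldType.
Implicit Types E F : topologicalLmodType C.

Lemma analytic_at_near E F (f g : E -> F) a :
  (\forall x \near a, f x = g x) -> analytic_at f a -> analytic_at g a.
Proof.
move=> fg [fa [P [hP sP tP]]].
have shift0 h : (fun t : C^o => a + t *: h) @ (0 : C^o) --> a.
  by have := @cvg_line _ _ a h (0 : C^o); rewrite scale0r addr0.
have add0 : (fun h => a + h) @ (0 : E) --> a.
  suff : (fun h => a + h) @ (0 : E) --> a + 0 by rewrite addr0.
  by apply: tvs_cvgD; [exact: cvg_cst|exact: cvg_id].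
have ga : g a = f a by rewrite (nbhs_singleton fg).
split.
  have fa' : f @ a --> f a by exact: fa.
  have : g @ a --> g a by rewrite ga; apply: cvg_trans fa'; apply: near_eq_cvg.
  exact.
exists P; split => //.
  have fg0 : \forall h \near (0 : E), f (a + h) = g (a + h) := add0 _ fg.
  by apply: filterS2 fg0 sP => h /= <-.
move=> m h; apply: cvg_trans (tP m h); apply: near_eq_cvg.
have fg0 : \forall t \near (0 : C^o), f (a + t *: h) = g (a + t *: h) :=
  shift0 h _ fg.
by apply: (@nbhs_dnbhs C^o); apply: filterS fg0 => t /= ->.
Qed.

Lemma cont_homog_poly_comp E' E F F' k (P : E -> F) (L : E' -> E) (M : F -> F') :
  cont_linear L -> cont_linear M -> cont_homog_poly k P ->
  cont_homog_poly k (M \o P \o L).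
Proof.
move=> [lL cL] cM [Q [mQ cQ PQ]]; have [lM cM'] := cM.
have row_setE v i x : map_mx L (row_set v i x) = row_set (map_mx L v) i (L x).
  by apply/rowP => j; rewrite !mxE; case: ifP.
exists (fun v => M (Q (map_mx L v))); split.
- by move=> i v a x y; rewrite !row_setE lL mQ lM.
- move=> v; apply: (@continuous_comp _ _ _ (fun v => Q (map_mx L v)) M _ _ (cM' _)).
  apply: (@continuous_comp _ _ _ (fun v => map_mx L v) Q _ _ (cQ _)).
  apply: (@cvg_mx _ _ _ _ _ (@nbhs_filter _ v)) => i j; rewrite mxE; under eq_fun do rewrite mxE.
  by apply: (@continuous_comp _ _ _ (fun v : 'rV_k => v i j) L _ _ (cL _));
    exact: mx_entry_continuous.
- by move=> h /=; rewrite PQ; congr (M (Q _)); apply/rowP => j; rewrite !mxE.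
Qed.

(** The Taylor terms of the composite are those of [f] between [L] and [M]. The map [A] is affine
    with linear part [L], so that Z |-> Z (+) W with W fixed is covered as well as linear maps. *)
Lemma analytic_at_comp E' E F F' (f : E -> F) (A L : E' -> E) (M : F -> F') a :
  (forall x h, A (x + h) = A x + L h) -> cont_linear L -> cont_linear M ->
  analytic_at f (A a) -> analytic_at (M \o f \o A) a.
Proof.
move=> AL cL cM [fa [P [hP sP tP]]]; have [_ cL'] := cL; have [_ cM'] := cM.
have cA : continuous A.
  have -> : A = (fun y => A 0 + L y) by apply/funext => y; rewrite -AL add0r.
  by move=> x; apply: tvs_cvgD; [exact: cvg_cst|exact: cL'].
split.
  apply: (@continuous_comp _ _ _ (f \o A) M _ _ (cM' _)).
  by apply: continuous_comp; [exact: cA|exact: fa].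
exists (fun k => M \o P k \o L); split.
- by move=> k; exact: cont_homog_poly_comp.
- have L0 : L @ (0 : E') --> (0 : E).
    by have := cL' 0; rewrite /continuous_at (cont_linear0 cL).
  have sP' : \forall h \near (0 : E'),
    series (fun k => P k (L h)) @ \oo --> f (A a + L h) := L0 _ sP.
  apply: filterS sP' => h sh /=; rewrite AL.
  have := cvg_comp _ _ sh (cM' _); apply: cvg_trans; apply: near_eq_cvg.
  apply: nearW => n /=; rewrite /series /=.
  by rewrite (cont_linear_sum _ _ _ cM).
- move=> m h; have := cvg_comp _ _ (tP m (L h)) (cM' 0).
  rewrite (cont_linear0 cM); apply: cvg_trans; apply: near_eq_cvg; apply: nearW.
  move=> t /=; rewrite (cont_linearZ _ _ cM) (cont_linearB _ _ cM).
  rewrite (cont_linear_sum _ _ _ cM) AL (cont_linearZ _ _ cL).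
  by congr (_ *: (_ - _)); apply: eq_bigr => k _; rewrite (cont_linearZ _ _ cM).
Qed.

Lemma analytic_at_add E F (f g : E -> F) a :
  analytic_at f a -> analytic_at g a -> analytic_at (fun x => f x + g x) a.
Proof.
move=> [fa [P [hP sP tP]]] [ga [Q [hQ sQ tQ]]]; split; first exact: tvs_cvgD.
exists (fun k h => P k h + Q k h); split.
- move=> k; have [K [mK cK KE]] := hP k; have [K' [mK' cK' KE']] := hQ k.
  exists (fun v => K v + K' v); split=> [i v c x y|v|h]; last by rewrite KE KE'.
    by rewrite mK mK' scalerDr addrACA.
  by apply: (@tvs_cvgD _ _ _ _ (@nbhs_filter _ v)); [exact: cK|exact: cK'].
- apply: filterS2 sP sQ => h Ph Qh.
  apply: cvg_trans (tvs_cvgD Ph Qh); apply: near_eq_cvg.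
  by apply: nearW => n; rewrite /series /= big_split.
- move=> m h; rewrite -[in X in _ --> X](addr0 0).
  apply: cvg_trans (tvs_cvgD (tP m h) (tQ m h)); apply: near_eq_cvg; apply: nearW => t.
  rewrite -scalerDr addrACA -opprD -big_split /=.
  by congr (_ *: (_ - _)); apply: eq_bigr => k _; rewrite scalerDr.
Qed.

End AnalyticAt.

(** * The identity theorem *)

Section Identity.
Variables (R : realType) (E F : topologicalLmodType R[i]).
Hypothesis hF : hausdorff_space F.
Implicit Types (f g : E -> F) (a h : E).

Lemma cvg_real_line a h (t : R) :
  (fun s : R => a + s%:C *: h) @ t --> a + t%:C *: h.
Proof.
exact: cvg_comp _ _ (@real_complex_continuous R t) (cvg_line a h (t%:C : R[i]^o)).
Qed.
Arguments cvg_real_line a h t : clear implicits.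

(* Coincidence on the left half of the line forces, by the Peano estimates, the
   Taylor terms of [f] and [g] to agree in every positive direction. *)
Lemma analytic_coincide_right f g a h :
  analytic_at f a -> analytic_at g a ->
  (\forall t \near (0 : R)^'-, f (a + t%:C *: h) = g (a + t%:C *: h)) ->
  \forall t \near (0 : R), 0 <= t -> f (a + t%:C *: h) = g (a + t%:C *: h).
Proof.
move=> [fa [P [_ sP tP]]] [ga [Q [_ sQ tQ]]] fg.
have line0 : (fun t : R => a + t%:C *: h) @ (0 : R)^'- --> a.
  apply: cvg_at_left_filter.
  by have := cvg_real_line a h 0; rewrite scale0r addr0.
have fga : f a = g a.
  have f0 : (fun t : R => f (a + t%:C *: h)) @ (0 : R)^'- --> f a.
    exact: cvg_comp _ _ line0 fa.
  have g0 : (fun t : R => g (a + t%:C *: h)) @ (0 : R)^'- --> g a.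
    exact: cvg_comp _ _ line0 ga.
  apply: (cvg_unique hF f0); apply: cvg_trans g0; apply: near_eq_cvg.
  by apply: filterS fg => t /= ->.
(* Strong induction on the degree: subtracting the Peano estimates of order m on the left, where [f]
   and [g] agree, cancels all lower terms and leaves the constant Q_m - P_m, which must then tend to
   0. *)
have PQ (tau : R) : 0 < tau -> forall m, P m (tau%:C *: h) = Q m (tau%:C *: h).
  move=> tau0; elim/ltn_ind => m IH.
  have i0 : tau^-1 != 0 by rewrite invr_eq0 gt_eqF.
  have Pm := cvg_comp _ _ (cvg_real_complex_dnbhs0 i0) (tP m (tau%:C *: h)).
  have Qm := cvg_comp _ _ (cvg_real_complex_dnbhs0 i0) (tQ m (tau%:C *: h)).
  have PQm := tvs_cvgD Pm (tvs_cvgN Qm).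
  rewrite subr0 in PQm.
  apply/eqP; rewrite eq_sym -subr_eq0; apply/eqP.
  refine (cvg_unique hF _ (PQm _ _)).
  apply: cvg_near_cst; near=> s.
  have s0 : s < 0 by near: s; exact: nbhs_left_lt.
  (* The Taylor terms are taken at [tau *: h], so the parameter s / tau is the one that reaches the
     point [a + s *: h] of coincidence. *)
  have sE : (s * tau^-1)%:C *: (tau%:C *: h) = s%:C *: h.
    by rewrite scalerA -rmorphM mulfVK // gt_eqF.
  rewrite /= sE.
  have -> : f (a + s%:C *: h) = g (a + s%:C *: h) by near: s.
  rewrite -scalerBr opprB addrC subrKA.
  rewrite !big_ord_recr /=.
  rewrite (eq_bigr (fun k : 'I_m => (s / tau)%:C ^+ k *: P k (tau%:C *: h))); last first.
    by move=> k _; rewrite IH ?ltn_ord.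
  rewrite opprD addrACA subrr add0r -scalerBr scalerA mulVf ?scale1r //.
  by rewrite expf_neq0 // (inj_eq (@complexI _) _ 0) mulf_neq0 // lt_eqF.
have line00 : (fun t : R => t%:C *: h) @ (0 : R) --> (0 : E).
  have := cvg_real_line 0 h 0; rewrite scale0r addr0; apply: cvg_trans.
  by apply: near_eq_cvg; apply: nearW => t; rewrite add0r.
have sP' : \forall t \near (0 : R),
  series (fun k => P k (t%:C *: h)) @ \oo --> f (a + t%:C *: h) := line00 _ sP.
have sQ' : \forall t \near (0 : R),
  series (fun k => Q k (t%:C *: h)) @ \oo --> g (a + t%:C *: h) := line00 _ sQ.
apply: filterS2 sP' sQ' => t Pt Qt.
rewrite le_eqVlt => /predU1P[<-|t0]; first by rewrite scale0r addr0.
have PQt : (fun k => P k (t%:C *: h)) = (fun k => Q k (t%:C *: h)).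
  by apply/funext => k; exact: PQ.
by rewrite PQt in Pt; refine (cvg_unique hF Pt Qt).
Unshelve. all: by end_near. Qed.

(** Real induction along the segment: agreement on [0, t) is agreement to the left of t, which
    [analytic_coincide_right] carries to t and beyond. *)
Lemma analytic_identity_segment f g q d :
  (forall t : R, 0 <= t <= 1 -> analytic_at f (q + t%:C *: d)) ->
  (forall t : R, 0 <= t <= 1 -> analytic_at g (q + t%:C *: d)) ->
  (\forall x \near q, f x = g x) -> f (q + d) = g (q + d).
Proof.
move=> fan gan fg.
have shift (t s : R) : q + t%:C *: d + s%:C *: d = q + (t + s)%:C *: d.
  by rewrite -addrA -scalerDl -rmorphD.
have extend t : 0 < t <= 1 ->
    (forall s, 0 <= s < t -> f (q + s%:C *: d) = g (q + s%:C *: d)) ->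
    \forall s \near (0 : R), 0 <= s ->
      f (q + (t + s)%:C *: d) = g (q + (t + s)%:C *: d).
  move=> /andP[t0 t1] fgt; have t01 : 0 <= t <= 1 by rewrite ltW.
  have := analytic_coincide_right (fan t t01) (gan t t01) (h := d).
  under eq_near do rewrite shift.
  move=> H; apply: filterS (H _) => [s + s0|]; first by rewrite shift; exact.
  near=> s; apply: fgt; rewrite gtrDl andbC; apply/andP; split.
    by near: s; exact: nbhs_left_lt.
  rewrite -lerBlDl sub0r; near: s; apply: nbhs_left_ge.
  by rewrite oppr_lt0.
suff fg1 t : 0 <= t <= 1 -> f (q + t%:C *: d) = g (q + t%:C *: d).
  by have := fg1 1; rewrite scale1r; apply; rewrite lexx ler01.
move: t; apply: real_induction => [|t /andP[t0 t1] fgt|t t01 fgt].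
- by rewrite scale0r addr0 (nbhs_singleton fg).
- have : \forall s \near (0 : R), 0 <= s ->
      f (q + (t + s)%:C *: d) = g (q + (t + s)%:C *: d).
    (* At t = 0 nothing is known on the left; the agreement near [q] takes its place. *)
    move: t0; rewrite le_eqVlt => /predU1P[<-|t0].
      have fg0 : \forall s \near (0 : R), f (q + s%:C *: d) = g (q + s%:C *: d).
        by have c := cvg_real_line q d 0; rewrite scale0r addr0 in c; exact: c _ fg.
      by apply: filterS fg0 => s; rewrite add0r.
    apply: extend; first by rewrite t0 ltW.
    by move=> s /andP[s0 st]; apply: fgt; rewrite s0 ltW.
  move=> /nbhs_ballP[e /= e0 He]; exists e => // s /andP[ts se] _.
  have := He (s - t); rewrite subrKC; apply; last by rewrite subr_ge0 ltW.
  by rewrite /ball /= sub0r normrN gtr0_norm ?subr_gt0 // ltrBlDl.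
- by have := nbhs_singleton (extend t t01 fgt); rewrite addr0; exact.
Unshelve. all: by end_near. Qed.

End Identity.

(** * Uniqueness of analytic continuation *)

Section Continuation.
Variable R : realType.
Implicit Types E F : topologicalLmodType R[i].

Lemma path_continuousP (T : topologicalType) (gamma : R -> T) :
  {within `[0, 1], continuous gamma} <->
  forall t, 0 <= t <= 1 -> forall N, nbhs (gamma t) N ->
    exists2 e, 0 < e & forall s, 0 <= s <= 1 -> `|s - t| < e -> N (gamma s).
Proof.
split=> [/subspace_continuousP cg t t01 N tN|cg].
  have : [set` `[0 : R, 1]] t by rewrite /= in_itv.
  move=> /(cg t)/(_ N tN); rewrite /within /= => /nbhs_ballP[e /= e0 eN].
  exists e => // s s01 st; apply: eN; last by rewrite /= in_itv.
  by rewrite /ball /= distrC.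
apply/subspace_continuousP => t /=; rewrite in_itv /= => t01 N tN.
have [e e0 eN] := cg t t01 N tN.
apply/nbhs_ballP; exists e => //= s; rewrite /ball /= distrC => st.
by rewrite in_itv /= => s01; exact: eN.
Qed.

(** The segment from [p] to [p] lies in [U], and by compactness of [0, 1] so does every segment
    whose ends are close enough to [p]. This stands in for a convex neighbourhood, which need not
    exist without local convexity. *)
Lemma segment_nbhs E (U : set E) (p : E) : open U -> U p ->
  exists W, [/\ open W, W p & forall q x, W q -> W x ->
    forall t : R, 0 <= t <= 1 -> U (q + t%:C *: (x - q))].
Proof.
move=> oU Up.
have /compact_near_coveringP := @segment_compact R 0 1.
move=> /(_ _ (nbhs (p, p)) (fun qx t => U (qx.1 + t%:C *: (qx.2 - qx.1)))).
have pE (t : R) : p + t%:C *: (p - p) = p by rewrite subrr scaler0 addr0.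
case=> [t _|[W1 W2] [/= pW1 pW2] W12].
  have lim : (fun z : R * (E * E) => z.2.1 + z.1%:C *: (z.2.2 - z.2.1))
      @ (t, (p, p)) --> p + t%:C *: (p - p).
    have FF : Filter (nbhs (t, (p, p))) by exact: nbhs_filter.
    have fst2 : (fun z : R * (E * E) => z.2.1) @ (t, (p, p)) --> p.
      by apply: (cvg_comp _ _ (@cvg_snd _ _ _ _ _)); exact: cvg_fst.
    have snd2 : (fun z : R * (E * E) => z.2.2) @ (t, (p, p)) --> p.
      by apply: (cvg_comp _ _ (@cvg_snd _ _ _ _ _)); exact: cvg_snd.
    have c1 : (fun z : R * (E * E) => z.1%:C : R[i]^o) @ (t, (p, p)) --> (t%:C : R[i]^o).
      apply: (cvg_comp _ _ (@cvg_fst _ _ _ _ _)); exact: real_complex_continuous.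
    exact: (@tvs_cvgD _ _ _ _ FF _ _ _ _ fst2
      (@tvs_cvgZ _ _ _ _ FF _ _ _ _ c1
        (@tvs_cvgD _ _ _ _ FF _ _ _ _ snd2 (@tvs_cvgN _ _ _ _ FF _ _ fst2)))).
  by have := lim U; rewrite pE => /(_ (open_nbhs_nbhs (conj oU Up))).
exists (W1 `&` W2)°; split; first exact: open_interior.
  by rewrite /interior; exact: filterI.
move=> q x /interior_subset[qW1 _] /interior_subset[_ xW2] t t01.
by apply: (W12 (q, x)) => //=; rewrite in_itv.
Qed.

(* The index [theta] ranges over a filter: the pieces of the family need only be
   defined and compatible eventually, but on an open set independent of it. *)
Definition analytic_family E F (T : Type) (Theta : set_system T) (gamma : R -> E)
    (P : T -> R -> E -> F) :=
  forall t, 0 <= t <= 1 -> exists U, [/\ open U, U (gamma t),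
    \forall theta \near Theta, analytic_on U (P theta t) &
    exists2 e, 0 < e & forall s, 0 <= s <= 1 -> `|s - t| < e ->
      \forall theta \near Theta, \forall x \near gamma s,
        P theta s x = P theta t x].

(** Eventual agreement of the germs at [gamma t] is a locally constant property of t, so real
    induction takes it from 0 to 1. *)
Lemma continuation_unique E F (T : Type) (Theta : set_system T)
    (FTheta : Filter Theta) (gamma : R -> E) (P Q : T -> R -> E -> F) :
  hausdorff_space F -> {within `[0, 1], continuous gamma} ->
  analytic_family Theta gamma P -> analytic_family Theta gamma Q ->
  (\forall theta \near Theta, \forall x \near gamma 0, P theta 0 x = Q theta 0 x) ->
  \forall theta \near Theta, \forall x \near gamma 1, P theta 1 x = Q theta 1 x.
Proof.
move=> hF /path_continuousP cg aP aQ PQ0.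
pose S t := \forall theta \near Theta, \forall x \near gamma t,
  P theta t x = Q theta t x.
have S_local t : 0 <= t <= 1 -> exists2 e, 0 < e &
    forall s, 0 <= s <= 1 -> `|s - t| < e -> (S s <-> S t).
  move=> t01.
  have [U [oU Ut anP [e1 e10 locP]]] := aP t t01.
  have [V [oV Vt anQ [e2 e20 locQ]]] := aQ t t01.
  have [W [oW Wt segW]] := segment_nbhs (openI oU oV) (conj Ut Vt).
  have [e3 e30 locW] := cg t t01 W (open_nbhs_nbhs (conj oW Wt)).
  exists (Num.min e1 (Num.min e2 e3)); first by rewrite !lt_min e10 e20.
  move=> s s01; rewrite !lt_min => /and3P[st1 st2 st3].
  have Ws := locW s s01 st3.
  (* Segments between points of [W] stay where both pieces at time t are analytic, so agreement near
     one point of [W] gives agreement near any other. *)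
  have spread q x : W q -> W x -> \forall theta \near Theta,
      (\forall y \near q, P theta t y = Q theta t y) ->
      \forall y \near x, P theta t y = Q theta t y.
    move=> Wq Wx; apply: filterS2 anP anQ => theta anP anQ PQq.
    have := open_nbhs_nbhs (conj oW Wx); apply: filterS => y Wy.
    have := analytic_identity_segment (f := P theta t) (g := Q theta t) hF
      (q := q) (d := y - q); rewrite subrKC; apply => // r r01.
      by have [? ?] := segW q y Wq Wy r r01; exact: anP.
    by have [? ?] := segW q y Wq Wy r r01; exact: anQ.
  have locP' := locP s s01 st1; have locQ' := locQ s s01 st2.
  split=> [Ss|St].
    apply: filterS2 (filterI locP' locQ') (filterI Ss (spread _ _ Ws Wt)).
    move=> theta [Ps Qs] [PQs]; apply; apply: filterS2 (filterI Ps Qs) PQs.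
    by move=> x [-> ->].
  apply: filterS2 (filterI locP' locQ') (filterI St (spread _ _ Wt Ws)).
  move=> theta [Ps Qs] [PQt PQts]; apply: filterS2 (filterI Ps Qs) (PQts PQt).
  by move=> x [-> ->].
rewrite -/(S 1).
have S01 : forall t, 0 <= t <= 1 -> S t; last by apply: S01; rewrite lexx ler01.
apply: real_induction => // t /andP[t0 t1] St.
  have t01 : 0 <= t <= 1 by rewrite t0 ltW.
  have [e e0 eS] := S_local t t01; exists e => // s /andP[ts ste] s1.
  apply/eS; [by rewrite s1 (le_trans t0 (ltW ts))| |by apply: St; rewrite t0 lexx].
  by rewrite gtr0_norm ?subr_gt0 // ltrBlDl.
have t01 : 0 <= t <= 1 by rewrite (ltW t0).
have [e e0 eS] := S_local t t01.
(* A time in [0, t) at distance less than [e] from t. *)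
pose s := Num.max 0 (t - e / 2).
have st : s < t by rewrite gt_max t0 ltrBlDr ltrDl divr_gt0.
have s0 : 0 <= s by rewrite le_max lexx.
apply/(eS s); last by apply: St; rewrite s0.
  by rewrite s0 (le_trans (ltW st) t1).
rewrite ltr0_norm ?subr_lt0 // opprB ltrBlDl -ltrBlDr.
rewrite lt_max; apply/orP; right; rewrite ltrD2l ltrN2.
by rewrite ltr_pdivrMr // ltr_pMr // ltr1n.
Qed.

End Continuation.

(** * Scalar matrices acting on matrices over a module *)

Local Close Scope complex_scope.
Local Open Scope sesquilinear_scope.

Section ModuleMatrix.
Variables (K : comNzRingType) (V : lmodType K).

(** Rectangular scalar matrices are allowed, so that a relation T Y = X T can link matrices X and Y
    of different levels. *)
Definition lmx m n p (A : 'M[K]_(m, n)) (X : 'M[V]_(n, p)) : 'M[V]_(m, p) :=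
  \matrix_(i, j) \sum_k A i k *: X k j.

Definition rmx m n p (X : 'M[V]_(m, n)) (A : 'M[K]_(n, p)) : 'M[V]_(m, p) :=
  \matrix_(i, j) \sum_k A k j *: X i k.

(** Most rules for [rmx] below are transposes of rules for [lmx]. *)
Lemma trmx_rmx m n p (X : 'M[V]_(m, n)) (A : 'M[K]_(n, p)) :
  (rmx X A)^T = lmx A^T X^T.
Proof. by apply/matrixP => i j; rewrite !mxE; apply: eq_bigr => k _; rewrite !mxE. Qed.

Lemma lmxA m n p q (A : 'M[K]_(m, n)) (B : 'M[K]_(n, p)) (X : 'M[V]_(p, q)) :
  lmx A (lmx B X) = lmx (A *m B) X.
Proof.
apply/matrixP => i j; rewrite !mxE.
under eq_bigr => k _ do rewrite mxE scaler_sumr.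
rewrite exchange_big /=; apply: eq_bigr => l _.
by rewrite mxE scaler_suml; apply: eq_bigr => k _; rewrite scalerA.
Qed.

Lemma rmxA m n p q (X : 'M[V]_(m, n)) (A : 'M[K]_(n, p)) (B : 'M[K]_(p, q)) :
  rmx (rmx X A) B = rmx X (A *m B).
Proof. by apply: trmx_inj; rewrite !trmx_rmx lmxA trmx_mul. Qed.

Lemma lrmxA m n p q (A : 'M[K]_(m, n)) (X : 'M[V]_(n, p)) (B : 'M[K]_(p, q)) :
  rmx (lmx A X) B = lmx A (rmx X B).
Proof.
apply/matrixP => i j; rewrite !mxE.
under eq_bigr => k _ do rewrite mxE scaler_sumr.
rewrite exchange_big /=; apply: eq_bigr => l _.
by rewrite mxE scaler_sumr; apply: eq_bigr => k _; rewrite !scalerA mulrC.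
Qed.

Lemma lmx1 m n (X : 'M[V]_(m, n)) : lmx 1%:M X = X.
Proof.
apply/matrixP => i j; rewrite mxE (bigD1 i) //= mxE eqxx scale1r big1 ?addr0 //.
by move=> k ki; rewrite mxE eq_sym (negPf ki) scale0r.
Qed.

Lemma rmx1 m n (X : 'M[V]_(m, n)) : rmx X 1%:M = X.
Proof. by apply: trmx_inj; rewrite trmx_rmx trmx1 lmx1. Qed.

Lemma lmx0 m n p (X : 'M[V]_(n, p)) : lmx (0 : 'M[K]_(m, n)) X = 0.
Proof. by apply/matrixP => i j; rewrite !mxE big1 // => k _; rewrite mxE scale0r. Qed.

Lemma lmx0r m n p (A : 'M[K]_(m, n)) : lmx A (0 : 'M[V]_(n, p)) = 0.
Proof. by apply/matrixP => i j; rewrite !mxE big1 // => k _; rewrite mxE scaler0. Qed.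

Lemma rmx0 m n p (X : 'M[V]_(m, n)) : rmx X (0 : 'M[K]_(n, p)) = 0.
Proof. by apply: trmx_inj; rewrite trmx_rmx !trmx0 lmx0. Qed.

Lemma rmx0l m n p (A : 'M[K]_(n, p)) : rmx (0 : 'M[V]_(m, n)) A = 0.
Proof. by apply: trmx_inj; rewrite trmx_rmx !trmx0 lmx0r. Qed.

Lemma lmxDl m n p (A B : 'M[K]_(m, n)) (X : 'M[V]_(n, p)) :
  lmx (A + B) X = lmx A X + lmx B X.
Proof.
apply/matrixP => i j; rewrite !mxE -big_split /=.
by apply: eq_bigr => k _; rewrite mxE scalerDl.
Qed.

Lemma rmxDr m n p (X : 'M[V]_(m, n)) (A B : 'M[K]_(n, p)) :
  rmx X (A + B) = rmx X A + rmx X B.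
Proof. by apply: trmx_inj; rewrite raddfD /= !trmx_rmx raddfD /= lmxDl. Qed.

Lemma lmxZl m n p a (A : 'M[K]_(m, n)) (X : 'M[V]_(n, p)) :
  lmx (a *: A) X = map_mx ( *:%R a) (lmx A X).
Proof.
apply/matrixP => i j; rewrite !mxE scaler_sumr.
by apply: eq_bigr => k _; rewrite mxE scalerA.
Qed.

Lemma rmxZr m n p a (A : 'M[K]_(n, p)) (X : 'M[V]_(m, n)) :
  rmx X (a *: A) = map_mx ( *:%R a) (rmx X A).
Proof.
apply/matrixP => i j; rewrite !mxE scaler_sumr.
by apply: eq_bigr => k _; rewrite mxE scalerA.
Qed.

Lemma lmxN m n p (A : 'M[K]_(m, n)) (X : 'M[V]_(n, p)) : lmx (- A) X = - lmx A X.
Proof.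
by rewrite -scaleN1r lmxZl; apply/matrixP => i j; rewrite !mxE scaleN1r.
Qed.

Lemma rmxN m n p (X : 'M[V]_(m, n)) (A : 'M[K]_(n, p)) : rmx X (- A) = - rmx X A.
Proof.
by rewrite -scaleN1r rmxZr; apply/matrixP => i j; rewrite !mxE scaleN1r.
Qed.

Lemma lmx_block m1 m2 n1 n2 p1 p2 (A : 'M[K]_(m1, n1)) B C
    (D : 'M[K]_(m2, n2)) (X : 'M[V]_(n1, p1)) Y Z (W : 'M[V]_(n2, p2)) :
  lmx (block_mx A B C D) (block_mx X Y Z W) =
  block_mx (lmx A X + lmx B Z) (lmx A Y + lmx B W)
           (lmx C X + lmx D Z) (lmx C Y + lmx D W).
Proof.
apply/matrixP => i j; rewrite mxE big_split_ord /=.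
by case: (split_ordP i) => i' ->; case: (split_ordP j) => j' ->;
  rewrite ?(block_mxEul, block_mxEur, block_mxEdl, block_mxEdr) !mxE;
  congr (_ + _); apply: eq_bigr => k _;
  rewrite ?(block_mxEul, block_mxEur, block_mxEdl, block_mxEdr).
Qed.

Lemma rmx_block m1 m2 n1 n2 p1 p2 (A : 'M[K]_(m1, n1)) B C
    (D : 'M[K]_(m2, n2)) (X : 'M[V]_(p1, m1)) Y Z (W : 'M[V]_(p2, m2)) :
  rmx (block_mx X Y Z W) (block_mx A B C D) =
  block_mx (rmx X A + rmx Y C) (rmx X B + rmx Y D)
           (rmx Z A + rmx W C) (rmx Z B + rmx W D).
Proof.
apply: trmx_inj; rewrite trmx_rmx !tr_block_mx lmx_block.
by rewrite !raddfD /= !trmx_rmx.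
Qed.

Lemma lmx_col m1 m2 n p (A : 'M[K]_(m1, n)) (B : 'M[K]_(m2, n)) (X : 'M[V]_(n, p)) :
  lmx (col_mx A B) X = col_mx (lmx A X) (lmx B X).
Proof.
apply/matrixP => i j; rewrite mxE.
by case: (split_ordP i) => i' ->; rewrite ?(col_mxEu, col_mxEd) mxE;
  apply: eq_bigr => k _; rewrite ?(col_mxEu, col_mxEd).
Qed.

Lemma lmx_row_col m n1 n2 p (A : 'M[K]_(m, n1)) (B : 'M[K]_(m, n2))
    (X : 'M[V]_(n1, p)) (Y : 'M[V]_(n2, p)) :
  lmx (row_mx A B) (col_mx X Y) = lmx A X + lmx B Y.
Proof.
apply/matrixP => i j; rewrite !mxE big_split_ord /=.
by congr (_ + _); apply: eq_bigr => k _;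
  rewrite ?(row_mxEl, row_mxEr, col_mxEu, col_mxEd).
Qed.

Lemma rmx_row m n p1 p2 (X : 'M[V]_(m, n)) (A : 'M[K]_(n, p1)) (B : 'M[K]_(n, p2)) :
  rmx X (row_mx A B) = row_mx (rmx X A) (rmx X B).
Proof. by apply: trmx_inj; rewrite tr_row_mx !trmx_rmx tr_row_mx lmx_col. Qed.

Lemma rmx_row_col m n1 n2 p (X : 'M[V]_(m, n1)) (Y : 'M[V]_(m, n2))
    (A : 'M[K]_(n1, p)) (B : 'M[K]_(n2, p)) :
  rmx (row_mx X Y) (col_mx A B) = rmx X A + rmx Y B.
Proof.
by apply: trmx_inj; rewrite raddfD /= !trmx_rmx tr_row_mx tr_col_mx lmx_row_col.
Qed.

End ModuleMatrix.

(** * Unitaries attached to projections, and partial isometries as intertwiners *)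

Section UnitaryConjugation.
Variable C : numClosedFieldType.
Implicit Types E F : topologicalLmodType C.

Lemma uconjE E n (U : 'M[C]_n) (X : mxlevel E n) :
  uconj U X = rmx (lmx (U ^t* ) X) U.
Proof.
rewrite lrmxA; apply/matrixP => i j; rewrite !mxE; apply: eq_bigr => k _.
by rewrite !mxE scaler_sumr; apply: eq_bigr => l _; rewrite scalerA.
Qed.

Lemma uconj1 E n (X : mxlevel E n) : uconj 1%:M X = X.
Proof. by rewrite uconjE rmx1 trmx1 map_mx1 lmx1. Qed.

Lemma uconj_fixed E n (U : 'M[C]_n) (X : mxlevel E n) : U \is unitarymx ->
  uconj U X = X <-> lmx U X = rmx X U.
Proof.
move=> uU; have UV : U *m U ^t* = 1%:M by exact/unitarymxP.
have VU := mulmx1C UV; rewrite uconjE.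
split=> [XE|UX]; last by rewrite lrmxA -UX lmxA VU lmx1.
by rewrite -[in LHS]XE lrmxA lmxA UV lmx1.
Qed.

Lemma trmxC_mul m n p (A : 'M[C]_(m, n)) (B : 'M[C]_(n, p)) :
  (A *m B) ^t* = B ^t* *m A ^t*.
Proof. by rewrite trmx_mul map_mxM. Qed.

Lemma trmxC_block m1 m2 n1 n2 (A : 'M[C]_(m1, n1)) B D (G : 'M[C]_(m2, n2)) :
  (block_mx A B D G) ^t* = block_mx (A ^t* ) (D ^t* ) (B ^t* ) (G ^t* ).
Proof. by rewrite tr_block_mx map_block_mx. Qed.

(** For an orthogonal projection [Q], this is w on the range of [Q] and 1 on its orthogonal
    complement. *)
Definition proj_unitary n (Q : 'M[C]_n) (w : C) : 'M[C]_n := 1%:M + (w - 1) *: Q.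

(** With u the conjugate of w, the coefficient of [Q] in the product with the adjoint is (w - 1) +
    (u - 1) + (w - 1)(u - 1) = w u - 1 = 0. *)
Lemma proj_unitaryP n (Q : 'M[C]_n) w : Q ^t* = Q -> Q *m Q = Q ->
  w * w^* = 1 -> proj_unitary Q w \is unitarymx.
Proof.
move=> Qs QQ w1; apply/unitarymxP.
have -> : (proj_unitary Q w) ^t* = 1%:M + (w^* - 1) *: Q.
  rewrite /proj_unitary raddfD /= map_mxD trmx1 map_mx1; congr (_ + _).
  by rewrite linearZ /= map_mxZ Qs rmorphB rmorph1.
rewrite /proj_unitary mulmxDl mul1mx mulmxDr mulmx1 -scalemxAl -scalemxAr QQ scalerA.
rewrite -addrA -!scalerDl -[RHS]addr0; congr (_ + _).
rewrite mulrBr mulr1 mulrBl w1 mul1r.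
by rewrite [X in X *: _](_ : _ = 0) ?scale0r //; ring.
Qed.

(** The scalar w - 1 can be cancelled, so a single w other than 1 suffices to recover commutation
    with [Q]. *)
Lemma proj_unitary_comm E n (Q : 'M[C]_n) w (X : mxlevel E n) : w != 1 ->
  lmx (proj_unitary Q w) X = rmx X (proj_unitary Q w) <-> lmx Q X = rmx X Q.
Proof.
move=> w1; rewrite lmxDl rmxDr lmx1 rmx1 lmxZl rmxZr; split=> [/addrI|-> //].
move=> /matrixP XQ; apply/matrixP => i j; have := XQ i j.
by rewrite [LHS]mxE [RHS]mxE; apply: scalerI; rewrite subr_eq0.
Qed.

(* When [T] is a partial isometry, half of this matrix is the orthogonal
   projection onto the vectors [(T v, - v)], [v] in the initial space of [T]. *)
Definition intertwiner_mx m n (T : 'M[C]_(m, n)) : 'M[C]_(m + n) :=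
  block_mx (T *m T ^t* ) (- T) (- T ^t* ) (T ^t* *m T).

Lemma trmxCK m n (A : 'M[C]_(m, n)) : (A ^t* ) ^t* = A.
Proof. by apply/matrixP => i j; rewrite !mxE conjCK. Qed.

Lemma trmxCN m n (A : 'M[C]_(m, n)) : (- A) ^t* = - (A ^t* ).
Proof. by rewrite linearN map_mxN. Qed.

Lemma intertwiner_mx_adj m n (T : 'M[C]_(m, n)) :
  (intertwiner_mx T) ^t* = intertwiner_mx T.
Proof. by rewrite trmxC_block !trmxC_mul !trmxCN !trmxCK. Qed.

(** The hypothesis says that [T] is a partial isometry; each block of the square is then a sum of
    two equal terms. *)
Lemma intertwiner_mx_sq m n (T : 'M[C]_(m, n)) : T *m T ^t* *m T = T ->
  intertwiner_mx T *m intertwiner_mx T = 2 *: intertwiner_mx T.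
Proof.
move=> TTT; have TTT' : T ^t* *m T *m T ^t* = T ^t*.
  by rewrite -[RHS](congr1 (fun A => A ^t* ) TTT) !trmxC_mul trmxCK mulmxA.
rewrite /intertwiner_mx mulmx_block scale_block_mx.
rewrite !(mulmxN, mulNmx, opprK) !mulmxA TTT TTT' -!opprD.
by rewrite !scaler_nat !mulr2n !opprD.
Qed.

Lemma intertwiner_mx_comm E m n (T : 'M[C]_(m, n)) (X : mxlevel E m)
    (Y : mxlevel E n) :
  lmx T Y = rmx X T -> lmx (T ^t* ) X = rmx Y (T ^t* ) ->
  lmx (intertwiner_mx T) (dsum X Y) = rmx (dsum X Y) (intertwiner_mx T).
Proof.
move=> TY TX; rewrite /intertwiner_mx /dsum lmx_block rmx_block.
rewrite !(lmx0, lmx0r, rmx0, rmx0l, addr0, add0r) !lmxN !rmxN -!lmxA -!rmxA.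
by rewrite TX TY -!lrmxA TX TY.
Qed.

(** The relation is the upper right block of the commutation, up to sign. *)
Lemma intertwiner_mx_commE E m n (T : 'M[C]_(m, n)) (X : mxlevel E m)
    (Y : mxlevel E n) :
  lmx (intertwiner_mx T) (dsum X Y) = rmx (dsum X Y) (intertwiner_mx T) ->
  lmx T Y = rmx X T.
Proof.
rewrite /intertwiner_mx /dsum lmx_block rmx_block.
rewrite !(lmx0, lmx0r, rmx0, rmx0l, addr0, add0r) => /eq_block_mx[_ + _ _].
by rewrite lmxN rmxN => /oppr_inj.
Qed.

End UnitaryConjugation.

(** * Continuity of the matrix operations *)

Section LevelMaps.
Variable C : numClosedFieldType.
Implicit Types E F : topologicalLmodType C.

Lemma cont_linear_bigsum E F I (r : seq I) (L : I -> E -> F) :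
  (forall i, cont_linear (L i)) -> cont_linear (fun x => \sum_(i <- r) L i x).
Proof.
move=> cL; split=> [a x y|x].
  rewrite scaler_sumr -big_split; apply: eq_bigr => i _.
  by rewrite (cont_linearD _ _ (cL i)) (cont_linearZ _ _ (cL i)).
by apply: tvs_cvg_sum => i; have [_] := cL i; exact.
Qed.

Lemma cont_linear_entry E n (i j : 'I_n) : cont_linear (fun X : mxlevel E n => X i j).
Proof. by split=> [a X Y|X]; [rewrite !mxE|exact: mx_entry_continuous]. Qed.

Lemma cont_linear_mx E F n (L : E -> mxlevel F n) :
  (forall i j, cont_linear (fun x => L x i j)) -> cont_linear L.
Proof.
move=> cL; split=> [a x y|x].
  apply/matrixP => i j; rewrite !mxE.
  by rewrite (cont_linearD _ _ (cL i j)) (cont_linearZ _ _ (cL i j)).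
apply: (@cvg_mx _ _ _ _ _ (@nbhs_filter _ x)) => i j.
by have [_] := cL i j; exact.
Qed.

Lemma cont_linear_const0 E F : cont_linear (fun _ : E => 0 : F).
Proof. by split=> [a x y|x]; [rewrite scaler0 addr0|exact: cvg_cst]. Qed.

Lemma uconj_cont_linear E n (U : 'M[C]_n) : cont_linear (@uconj C E n U).
Proof.
apply: cont_linear_mx => i j.
have -> : (fun X : mxlevel E n => uconj U X i j) =
    (fun X => \sum_k \sum_l ((U k i)^* * U l j) *: (X k l)).
  by apply/funext => X; rewrite mxE.
apply: cont_linear_bigsum => k; apply: cont_linear_bigsum => l.
exact: cont_linear_comp (cont_linear_entry E k l) (cont_linear_scale E _).
Qed.

Definition ulblock E n m (X : mxlevel E (n + m)) : mxlevel E n := ulsubmx X.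
Definition drblock E n m (X : mxlevel E (n + m)) : mxlevel E m := drsubmx X.

Lemma ulblock_dsum E n m (X : mxlevel E n) (Y : mxlevel E m) :
  ulblock (dsum X Y) = X.
Proof. exact: block_mxKul. Qed.

Lemma drblock_dsum E n m (X : mxlevel E n) (Y : mxlevel E m) :
  drblock (dsum X Y) = Y.
Proof. exact: block_mxKdr. Qed.

Lemma ulblock_cont_linear E n m : cont_linear (@ulblock E n m).
Proof.
apply: cont_linear_mx => i j.
have -> : (fun X => @ulblock E n m X i j) = (fun X => X (lshift m i) (lshift m j)).
  by apply/funext => X; rewrite !mxE.
exact: cont_linear_entry.
Qed.

Lemma drblock_cont_linear E n m : cont_linear (@drblock E n m).
Proof.
apply: cont_linear_mx => i j.
have -> : (fun X => @drblock E n m X i j) = (fun X => X (rshift n i) (rshift n j)).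
  by apply/funext => X; rewrite !mxE.
exact: cont_linear_entry.
Qed.

Lemma dsum0r_cont_linear E n m :
  cont_linear (fun X : mxlevel E n => dsum X (0 : mxlevel E m)).
Proof.
apply: cont_linear_mx => i j; case: (split_ordP i) => i' ->;
  case: (split_ordP j) => j' ->; under eq_fun => X do
  rewrite ?(block_mxEul, block_mxEur, block_mxEdl, block_mxEdr) ?mxE.
- exact: cont_linear_entry.
- exact: cont_linear_const0.
- exact: cont_linear_const0.
- exact: cont_linear_const0.
Qed.

Lemma dsum0l_cont_linear E n m :
  cont_linear (fun X : mxlevel E m => dsum (0 : mxlevel E n) X).
Proof.
apply: cont_linear_mx => i j; case: (split_ordP i) => i' ->;
  case: (split_ordP j) => j' ->; under eq_fun => X do
  rewrite ?(block_mxEul, block_mxEur, block_mxEdl, block_mxEdr) ?mxE.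
- exact: cont_linear_const0.
- exact: cont_linear_const0.
- exact: cont_linear_const0.
- exact: cont_linear_entry.
Qed.

(** Writes the direct sum as a sum of two maps, each linear in one argument, for which continuity is
    already known. *)
Lemma dsumE E n m (X : mxlevel E n) (Y : mxlevel E m) :
  dsum X Y = dsum X 0 + dsum 0 Y.
Proof. by rewrite /dsum [RHS]add_block_mx !addr0 add0r. Qed.

Lemma dsumD E n m (X X' : mxlevel E n) (Y Y' : mxlevel E m) :
  dsum (X + X') (Y + Y') = dsum X Y + dsum X' Y'.
Proof. by rewrite /dsum [RHS]add_block_mx !addr0. Qed.

Lemma dsum_cvg E n m (T : Type) (G : set_system T) (FG : Filter G)
    (f : T -> mxlevel E n) (g : T -> mxlevel E m) X Y :
  f @ G --> X -> g @ G --> Y -> (fun t => dsum (f t) (g t)) @ G --> dsum X Y.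
Proof.
move=> fX gY; rewrite dsumE; under eq_fun do rewrite dsumE.
have [_ cl] := dsum0r_cont_linear E n m; have [_ cr] := dsum0l_cont_linear E n m.
by apply: tvs_cvgD; [exact: cvg_comp _ _ fX (cl X)|exact: cvg_comp _ _ gY (cr Y)].
Qed.

Lemma block_diag_cont_linear E n m :
  cont_linear (fun X : mxlevel E (n + m) => dsum (ulblock X) (drblock X)).
Proof.
under [X in cont_linear X]eq_fun do rewrite dsumE.
by apply: cont_linear_add; [move: (dsum0r_cont_linear E n m)|
  move: (dsum0l_cont_linear E n m)]; apply: cont_linear_comp;
  [exact: ulblock_cont_linear|exact: drblock_cont_linear].
Qed.

Lemma mxlevel_hausdorff E n : hausdorff_space E -> hausdorff_space (mxlevel E n).
Proof. exact: mx_hausdorff. Qed.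

Lemma conjC_continuous : continuous (fun z : C^o => z^* : C^o).
Proof.
move=> z; have FF : Filter (nbhs (z : C^o)) by exact: nbhs_filter.
apply/(@cvgrPdist_lt _ _ _ _ FF) => e e0.
have : \forall x \near (z : C^o), `|z - x| < e.
  by apply/nbhs_ballP; exists e.
by apply: filterS => x; rewrite -rmorphB norm_conjC.
Qed.

(** Convergence is joint in the unitary and the matrix, as needed when w tends to 1 while the point
    moves. *)
Lemma uconj_cvg E n (T : Type) (G : set_system T) (FG : Filter G)
    (U : T -> 'M[C]_n) (U0 : 'M[C]_n) (f : T -> mxlevel E n) X :
  (forall i j, (fun t => U t i j : C^o) @ G --> (U0 i j : C^o)) -> f @ G --> X ->
  (fun t => uconj (U t) (f t)) @ G --> uconj U0 X.
Proof.
move=> UU0 fX; apply: cvg_mx => i j; rewrite mxE.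
under eq_fun do rewrite mxE.
apply: tvs_cvg_sum => k; apply: tvs_cvg_sum => l; apply: tvs_cvgZ.
  have := cvgM (cvg_comp _ _ (UU0 k i) (@conjC_continuous _)) (UU0 l j).
  exact.
exact: cvg_comp _ _ fX (@mx_entry_continuous _ _ _ k l X).
Qed.

Lemma proj_unitary_cvg n (Q : 'M[C]_n) i j :
  (fun w => proj_unitary Q w i j : C^o) @ (1 : C^o) --> ((1%:M : 'M[C]_n) i j : C^o).
Proof.
have -> : (fun w => proj_unitary Q w i j) =
    (fun w : C^o => ((1%:M : 'M[C]_n) i j - Q i j : C^o) + w *: (Q i j : C^o)).
  by apply/funext => w; rewrite !mxE /GRing.scale /=; ring.
by have := @cvg_line C C^o ((1%:M : 'M[C]_n) i j - Q i j) (Q i j) (1 : C^o);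
  rewrite scale1r subrK.
Qed.

End LevelMaps.

(** * Unit complex numbers near 1 *)

Section Circle.
Variable R : realType.
Local Notation C := R[i].

(** The point 1 is removed because [proj_unitary Q 1] is the identity and says nothing about [Q]. *)
Definition circle_near1 : set_system C :=
  within [set w | w * w^* = 1 /\ w != 1] (nbhs (1 : C^o)).

#[global] Instance circle_near1_filter : ProperFilter circle_near1.
Proof.
have FF : Filter circle_near1.
  by apply: within_filter; exact: (@nbhs_filter C^o).
apply: Build_ProperFilter_ex => U.
rewrite /circle_near1 /within /= => /nbhs_ballP[e /= e0 Ue].
have [r eE] : exists r : R, e = r%:C%C.
  by exists (complex.Re e); apply/eqP; rewrite eq_sym RRe_real // gtr0_real.
rewrite {}eE in e0 Ue; rewrite ltcR in e0.
(* Rational parametrization of the circle: the squared distance of a + ib to 1 is (2t)^2 / (1 +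
   t^2), at most r^2 / 4 for t = r / 4, and b > 0 keeps the point away from 1. *)
pose t := r / 4; have t0 : 0 < t by rewrite divr_gt0.
have d0 : 1 + t ^+ 2 != 0 by rewrite gt_eqF // ltr_wpDr ?sqr_ge0.
pose a := (1 - t ^+ 2) / (1 + t ^+ 2); pose b := (2 * t) / (1 + t ^+ 2).
have ab : a ^+ 2 + b ^+ 2 = 1 by rewrite /a /b; field.
exists (a +i* b)%C; apply: Ue; last split.
- rewrite /ball /= normc_def ltcR /= sub0r sqrrN.
  have -> : (1 - a) ^+ 2 + b ^+ 2 = (2 * t) ^+ 2 / (1 + t ^+ 2).
    by rewrite /a /b; field.
  rewrite -(@ltr_pXn2r _ 2) ?nnegrE ?sqrtr_ge0 ?(ltW e0) // sqr_sqrtr; last first.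
    by rewrite divr_ge0 ?sqr_ge0 // addr_ge0 ?sqr_ge0.
  rewrite ltr_pdivrMr; last by rewrite ltr_wpDr ?sqr_ge0.
  rewrite /t; have := sqr_ge0 (r / 4); have : 0 < r ^+ 2 by rewrite exprn_gt0.
  by nra.
- by rewrite -normCK normc_def /= ab sqrtr1 expr1n.
- by rewrite eq_complex /= negb_and orbC mulf_neq0 // ?invr_eq0 // mulf_neq0 // gt_eqF.
Qed.

Lemma circle_near1_nbhs (N : set C) : nbhs (1 : C^o) N -> circle_near1 N.
Proof.
move=> N1; rewrite /circle_near1 /within /=.
by apply: (@filterS _ _ (@nbhs_filter C^o 1) _ _ _ N1) => w Nw _.
Qed.

Lemma circle_near1_on : \forall w \near circle_near1, w * w^* = 1 /\ w != 1.
Proof. exact: (@withinT _ _ _ (@nbhs_filter C^o 1)). Qed.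

End Circle.

(** * Continuation of free functions *)

Section AnalyticFamilies.
Variable R : realType.
Implicit Types E F : topologicalLmodType R[i].

(** The body of [continues_along] with its witnesses exposed, so that the last function element
    [g 1] can be named. *)
Definition continuation E F (f : E -> F) (gamma : R -> E) (U : R -> set E)
    (g : R -> E -> F) :=
  [/\ forall t, t \in `[0, 1] ->
        [/\ open (U t), U t (gamma t) & analytic_on (U t) (g t)],
      \forall x \near gamma 0, g 0 x = f x &
      forall t, t \in `[0, 1] ->
        exists2 e, 0 < e & forall s, s \in `[0, 1] -> `|s - t| < e ->
          U t (gamma s) /\ \forall x \near gamma s, g s x = g t x].

(** With [L] a block projection and [M] a block inclusion, continuations along two paths become
    families along the direct sum of the paths. *)
Lemma analytic_family_comp E E' F F' (T : Type) (Theta : set_system T)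
    (FTheta : Filter Theta) (f : E -> F) (gamma : R -> E') U g
    (L : E' -> E) (M : F -> F') :
  cont_linear L -> cont_linear M -> continuation f (L \o gamma) U g ->
  analytic_family Theta gamma (fun _ t => M \o g t \o L).
Proof.
move=> cL cM [ang _ loc] t t01; have [_ cL'] := cL.
have tI : t \in `[0, 1] by rewrite in_itv.
have [oU Ut an] := ang t tI; exists (L @^-1` U t); split => //.
- by apply: open_comp => // x _; exact: cL'.
- apply: nearW => _ x Ux; apply: (analytic_at_comp _ cL cM); last exact: an.
  by move=> y h; exact: cont_linearD.
have [e e0 et] := loc t tI; exists e => // s s01 st.
have [_ gst] := et s (introT idP s01) st.
apply: nearW => _; have : \forall x \near gamma s, g s (L x) = g t (L x) := cL' _ _ gst.
by apply: filterS => x /= ->.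
Qed.

Lemma analytic_family_add E F (T : Type) (Theta : set_system T)
    (FTheta : Filter Theta) (gamma : R -> E) (P Q : T -> R -> E -> F) :
  analytic_family Theta gamma P -> analytic_family Theta gamma Q ->
  analytic_family Theta gamma (fun theta t x => P theta t x + Q theta t x).
Proof.
move=> aP aQ t t01.
have [U [oU Ut anP [e1 e10 locP]]] := aP t t01.
have [V [oV Vt anQ [e2 e20 locQ]]] := aQ t t01.
exists (U `&` V); split => //; first exact: openI.
  apply: filterS2 anP anQ => theta anP anQ x [Ux Vx].
  by apply: analytic_at_add; [exact: anP|exact: anQ].
exists (Num.min e1 e2); first by rewrite lt_min e10.
move=> s s01; rewrite lt_min => /andP[st1 st2].
apply: filterS2 (locP s s01 st1) (locQ s s01 st2) => theta.
by apply: filterS2 => x -> ->.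
Qed.

(** Conjugation is jointly continuous in (w, Z) and fixes [X] at w = 1. The neighbourhood [W] is the
    same for all w near 1, as [analytic_family] demands. *)
Lemma near_proj_unitary (E : topologicalLmodType R[i]) n (Q : 'M[R[i]]_n)
    (X : mxlevel E n) (N : set (mxlevel E n)) : nbhs X N ->
  exists W, [/\ open W, W X & \forall w \near (@circle_near1 R),
    forall Z, W Z -> N (uconj (proj_unitary Q w) Z)].
Proof.
move=> XN; have FF : Filter (nbhs ((1 : R[i]^o), X)) by exact: nbhs_filter.
have lim : (fun z : R[i]^o * mxlevel E n => uconj (proj_unitary Q z.1) z.2)
    @ ((1 : R[i]^o), X) --> uconj 1%:M X.
  apply: (@uconj_cvg _ _ _ _ _ FF) => [i j|]; last exact: cvg_snd.
  have fst1 : (fun z : R[i]^o * mxlevel E n => z.1) @ ((1 : R[i]^o), X) --> (1 : R[i]^o).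
    by apply: cvg_fst; exact: (@nbhs_filter (mxlevel E n)).
  exact: (cvg_comp _ _ fst1 (@proj_unitary_cvg _ _ Q i j)).
have [|[W1 W2] [/= W11 W2X] W12] := lim N; first by rewrite uconj1.
exists W2°; split; first exact: open_interior.
  by rewrite /interior; exact: W2X.
apply: (@filterS _ _ (@circle_near1_filter R) _ _ _ (circle_near1_nbhs W11)) => w Ww Z /interior_subset WZ.
exact: (W12 (w, Z)).
Qed.

End AnalyticFamilies.

(** * End values of continuations and the global extension *)

Section Monodromy.
Variables (R : realType) (R1 R2 : topologicalLmodType R[i]).
Hypothesis hR2 : hausdorff_space R2.
Variable D : forall n, set (mxlevel R1 n).
Arguments D : clear implicits.
Hypothesis D_free : free_set D.
Hypothesis D_open : free_open D.
Hypothesis D_conn : free_connected D.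
Variable B : forall n, set (mxlevel R1 n).
Arguments B : clear implicits.
Hypothesis B_free : free_set B.
Hypothesis B_open : free_open B.
Hypothesis BD : forall n, B n `<=` D n.
Variable f : forall n, mxlevel R1 n -> mxlevel R2 n.
Arguments f : clear implicits.
Hypothesis f_an : free_analytic B f.
Hypothesis f_cont : forall n (gamma : R -> mxlevel R1 n),
  path_in (D n) gamma -> B n (gamma 0) -> continues_along (f n) gamma.

(** The whole last function element is kept rather than its value at [X], since the analyticity of
    the extension is read off from it. *)
Definition end_element n (X : mxlevel R1 n) (g : mxlevel R1 n -> mxlevel R2 n) :=
  exists (gamma : R -> mxlevel R1 n) U h, [/\ path_in (D n) gamma, B n (gamma 0),
    gamma 1 = X, continuation (f n) gamma U h & h 1 = g].

Lemma end_element_exists n (X : mxlevel R1 n) : B n !=set0 -> D n X ->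
  exists g, end_element X g.
Proof.
move=> [X0 BX0] DX; have [gamma [pg g0 g1]] := D_conn (BD BX0) DX.
have Bg : B n (gamma 0) by rewrite g0.
by have [U [h Uh]] := f_cont pg Bg; exists (h 1), gamma, U, h.
Qed.

Lemma end_element_base n (X : mxlevel R1 n) : B n X -> end_element X (f n).
Proof.
move=> BX; have [_ anf] := f_an.
exists (fun=> X), (fun=> B n), (fun=> f n); split => //.
  by split=> [|t _]; [apply: continuous_subspaceT => ?; exact: cvg_cst|exact: BD].
split=> [t _| |t _]; first by split; [exact: B_open|exact: BX|exact: anf].
  by apply: (@filterE _ _ (@nbhs_filter _ X)).
by exists 1 => // s _ _; split => //; apply: (@filterE _ _ (@nbhs_filter _ X)).
Qed.

Lemma end_element_analytic n (X : mxlevel R1 n) g :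
  end_element X g -> analytic_at g X.
Proof.
move=> [gamma [U [h [_ _ g1 [an _ _] <-]]]].
have I1 : (1 : R) \in `[0, 1] by rewrite bound_itvE.
by have [_ U1 an1] := an 1 I1; rewrite -g1; exact: an1.
Qed.

Lemma end_element_dsum n m (X : mxlevel R1 n) (Y : mxlevel R1 m) g g' :
  end_element X g -> end_element Y g' ->
  exists2 h, end_element (dsum X Y) h & h (dsum X Y) = dsum (g X) (g' Y).
Proof.
move=> [gam1 [U1 [g1 [[cg1 Dg1] Bg1 <- co1 <-]]]].
move=> [gam2 [U2 [g2 [[cg2 Dg2] Bg2 <- co2 <-]]]].
pose gam t := dsum (gam1 t) (gam2 t).
have [_ Dsum _] := D_free; have [_ Bsum _] := B_free.
have [[fsum _] _] := f_an.
have pgam : path_in (D (n + m)) gam.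
  split=> [|t t01]; last by apply: Dsum; [exact: Dg1|exact: Dg2].
  move/subspace_continuousP: cg1 => cg1; move/subspace_continuousP: cg2 => cg2.
  by apply/subspace_continuousP => t t01; apply: dsum_cvg; [exact: cg1|exact: cg2].
have Bgam : B (n + m)%N (gam 0) by exact: Bsum.
have [U [h co]] := f_cont pgam Bgam.
exists (h 1); first by exists gam, U, h.
have cul := ulblock_cont_linear R1 n m; have cdr := drblock_cont_linear R1 n m.
have cbd := block_diag_cont_linear R1 n m.
(* A one-point index set: here single continuations are compared. *)
pose Theta := globally [set: unit].
have FT : Filter Theta by exact: globally_filter.
have gamE : (fun X : mxlevel R1 (n + m) => dsum (ulblock X) (drblock X)) \o gam = gam.
  by apply/funext => t /=; rewrite ulblock_dsum drblock_dsum.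
have ulE : @ulblock _ R1 n m \o gam = gam1.
  by apply/funext => t /=; rewrite ulblock_dsum.
have drE : @drblock _ R1 n m \o gam = gam2.
  by apply/funext => t /=; rewrite drblock_dsum.
(* A point near [gam 0] need not be block diagonal, whereas [f] splits only on direct sums. Hence
   [h] is composed with the compression to the diagonal blocks, which fixes the path. *)
have aP : analytic_family Theta gam (fun _ t => id \o h t \o
    (fun X : mxlevel R1 (n + m) => dsum (ulblock X) (drblock X))).
  apply: (@analytic_family_comp _ _ _ _ _ _ _ _ (f (n + m)) _ U) => //.
    exact: cont_linear_id.
  by rewrite gamE.
have aQ1 : analytic_family Theta gam (fun _ t =>
    (fun Y : mxlevel R2 n => dsum Y (0 : mxlevel R2 m)) \o g1 t \o @ulblock _ R1 n m).
  apply: (@analytic_family_comp _ _ _ _ _ _ _ _ (f n) _ U1) => //.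
    exact: dsum0r_cont_linear.
  by rewrite ulE.
have aQ2 : analytic_family Theta gam (fun _ t =>
    (fun Y : mxlevel R2 m => dsum (0 : mxlevel R2 n) Y) \o g2 t \o @drblock _ R1 n m).
  apply: (@analytic_family_comp _ _ _ _ _ _ _ _ (f m) _ U2) => //.
    exact: dsum0l_cont_linear.
  by rewrite drE.
have [cgam _] := pgam.
have init : \forall theta \near Theta, \forall Z \near gam 0,
    h 0 (dsum (ulblock Z) (drblock Z)) =
    dsum (g1 0 (ulblock Z)) 0 + dsum 0 (g2 0 (drblock Z)).
  move=> [] _ /=.
  have [_ co10 _] := co1; have [_ co20 _] := co2; have [_ co0 _] := co.
  have ul0 : ulblock (gam 0) = gam1 0 by rewrite ulblock_dsum.
  have dr0 : drblock (gam 0) = gam2 0 by rewrite drblock_dsum.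
  have bd0 : dsum (ulblock (gam 0)) (drblock (gam 0)) = gam 0 by rewrite ul0 dr0.
  have nul N : nbhs (gam1 0) N -> \forall Z \near gam 0, N (ulblock Z).
    by rewrite -ul0 => H; have [_ c] := cul; exact: c _ _ H.
  have ndr N : nbhs (gam2 0) N -> \forall Z \near gam 0, N (drblock Z).
    by rewrite -dr0 => H; have [_ c] := cdr; exact: c _ _ H.
  have nbd N : nbhs (gam 0) N ->
      \forall Z \near gam 0, N (dsum (ulblock Z) (drblock Z)).
    by rewrite -[in nbhs _ N]bd0 => H; have [_ c] := cbd; exact: c _ _ H.
  have nB k (Z : mxlevel R1 k) : B k Z -> nbhs Z (B k).
    by move=> BZ; apply: open_nbhs_nbhs; split => //; exact: B_open.
  apply: filterS2 (filterI (nul _ co10) (ndr _ co20))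
    (filterI (nbd _ co0) (filterI (nul _ (nB _ _ Bg1)) (ndr _ (nB _ _ Bg2)))).
  by move=> Z [-> ->] [-> [BZ1 BZ2]]; rewrite fsum // -dsumE.
have /(_ tt I)/nbhs_singleton := continuation_unique FT
  (@mxlevel_hausdorff _ _ _ hR2) cgam aP (analytic_family_add FT aQ1 aQ2) init.
by rewrite /= ulblock_dsum drblock_dsum => ->; rewrite -dsumE.
Qed.

Lemma end_element_comm n (X : mxlevel R1 n) g (Q : 'M[R[i]]_n) :
  end_element X g -> Q ^t* = Q -> Q *m Q = Q -> lmx Q X = rmx X Q ->
  lmx Q (g X) = rmx (g X) Q.
Proof.
move=> [gam [U [h [[cg Dg] Bg <- [an h0 loc] <-]]]] Qs QQ QX.
have [[_ funi] _] := f_an; have [_ _ Buni] := B_free.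
have circ := @circle_near1_on R.
(* The conjugated point leaves the path, but for w near 1 it stays in the domain of the same
   function element. *)
have aP : analytic_family (@circle_near1 R) gam
    (fun w t Z => h t (uconj (proj_unitary Q w) Z)).
  move=> t t01; have tI : t \in `[0, 1] by rewrite in_itv.
  have [oU Ut ant] := an t tI.
  have [W [oW Wt WU]] := near_proj_unitary Q (open_nbhs_nbhs (conj oU Ut)).
  exists W; split => //.
    apply: filterS WU => w WU Z WZ.
    apply: (@analytic_at_comp _ _ _ _ _ (h t) (uconj (proj_unitary Q w)) _ id).
    - by move=> y k; apply: cont_linearD; exact: uconj_cont_linear.
    - exact: uconj_cont_linear.
    - exact: cont_linear_id.
    - by apply: ant; exact: WU.
  have [e e0 et] := loc t tI; exists e => // s s01 st.
  have [_ hst] := et s (introT idP s01) st.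
  have [W' [oW' Ws WN]] := near_proj_unitary Q hst.
  apply: filterS WN => w WN; have := open_nbhs_nbhs (conj oW' Ws).
  by apply: filterS => Z /WN.
have aQ : analytic_family (@circle_near1 R) gam
    (fun w t Z => uconj (proj_unitary Q w) (h t Z)).
  move=> t t01; have tI : t \in `[0, 1] by rewrite in_itv.
  have [oU Ut ant] := an t tI; exists (U t); split => //.
    apply: nearW => w Z UZ.
    apply: (@analytic_at_comp _ _ _ _ _ (h t) id id (uconj (proj_unitary Q w))) => //.
    - exact: cont_linear_id.
    - exact: uconj_cont_linear.
    - exact: ant.
  have [e e0 et] := loc t tI; exists e => // s s01 st.
  have [_ hst] := et s (introT idP s01) st.
  by apply: nearW => w; apply: filterS hst => Z ->.
have init : \forall w \near (@circle_near1 R), \forall Z \near gam 0,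
    h 0 (uconj (proj_unitary Q w) Z) = uconj (proj_unitary Q w) (h 0 Z).
  have [W [oW W0 WN]] := near_proj_unitary Q h0.
  apply: filterS2 WN circ => w WN [w1 _].
  have uw := proj_unitaryP Qs QQ w1.
  have nB : nbhs (gam 0) (B n).
    by apply: open_nbhs_nbhs; split => //; exact: B_open.
  apply: filterS2 (filterI h0 nB) (open_nbhs_nbhs (conj oW W0)).
  by move=> Z [hZ BZ] WZ; rewrite WN // hZ funi.
have final := continuation_unique _ (@mxlevel_hausdorff _ _ _ hR2) cg aP aQ init.
(* The filter is proper, so some unit w other than 1 is available; its unitary fixes [gam 1] and
   hence the end value. *)
have [w [[w1 wn1] /nbhs_singleton/esym]] := filter_ex (filterI circ (final _)).
have uw := proj_unitaryP Qs QQ w1.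
have /(uconj_fixed _ uw) -> : lmx (proj_unitary Q w) (gam 1) =
    rmx (gam 1) (proj_unitary Q w) by apply/proj_unitary_comm.
by move=> /(uconj_fixed _ uw)/(proj_unitary_comm _ _ wn1).
Qed.

(** The projection [Q], half of [intertwiner_mx T], commutes with X (+) Y, hence with the end value
    there, which is the direct sum of the two end values; the upper right block of this commutation
    is the claim. *)
Lemma end_element_intertwine n m (X : mxlevel R1 n) (Y : mxlevel R1 m) g g'
    (T : 'M[R[i]]_(n, m)) :
  end_element X g -> end_element Y g' -> T *m T ^t* *m T = T ->
  lmx T Y = rmx X T -> lmx (T ^t* ) X = rmx Y (T ^t* ) ->
  lmx T (g' Y) = rmx (g X) T.
Proof.
move=> Xg Yg' TTT TY TX; have [h Xh hE] := end_element_dsum Xg Yg'.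
pose Q := 2^-1 *: intertwiner_mx T.
have two0 : (2 : R[i]) != 0 by rewrite pnatr_eq0.
have commZ (E : topologicalLmodType R[i]) k (A : 'M[R[i]]_k) (Z : mxlevel E k) :
    lmx A Z = rmx Z A -> forall a, lmx (a *: A) Z = rmx Z (a *: A).
  by move=> AZ a; rewrite lmxZl rmxZr AZ.
have Qs : Q ^t* = Q.
  rewrite /Q linearZ /= map_mxZ intertwiner_mx_adj; congr (_ *: _).
  by rewrite fmorphV rmorph_nat.
have QQ : Q *m Q = Q.
  rewrite /Q -scalemxAl -scalemxAr intertwiner_mx_sq // !scalerA.
  by rewrite -mulrA mulVf // mulr1.
have QX := commZ _ _ _ _ (intertwiner_mx_comm TY TX) 2^-1.
have := commZ _ _ _ _ (end_element_comm Xh Qs QQ QX) 2.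
by rewrite /Q scalerA mulfV // scale1r hE => /intertwiner_mx_commE.
Qed.

Lemma end_element_unique n (X : mxlevel R1 n) g g' :
  end_element X g -> end_element X g' -> g X = g' X.
Proof.
move=> Xg Xg'; have T1 : (1%:M : 'M[R[i]]_n) ^t* = 1%:M by rewrite trmx1 map_mx1.
have := end_element_intertwine (T := 1%:M) Xg Xg'.
by rewrite T1 !mul1mx !lmx1 !rmx1 => ->.
Qed.

(* The path is run at double speed and then followed by the segment from [X] to
   [X'], which stays in the domain of the last function element. *)
Lemma end_element_near n (X : mxlevel R1 n) g : end_element X g ->
  \forall X' \near X, end_element X' g.
Proof.
move=> [gam [U [h [[cg Dg] Bg g1 [an h0 loc] hg]]]].
have I1 : (1 : R) \in `[0, 1] by rewrite bound_itvE.
have [oU1 U1 _] := an 1 I1; rewrite g1 in U1.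
have DX : D n X by rewrite -g1; exact: Dg.
have [W [oW WX segW]] := segment_nbhs (openI oU1 (@D_open n)) (conj U1 DX).
have := open_nbhs_nbhs (conj oW WX); apply: filterS => X' WX'.
have {}segW := segW _ _ WX WX'.
(* [c] is the time along [gam], which stops at 1 when t = 1/2; [d] is the time along the segment,
   which starts there. *)
pose c (t : R) := Num.min (2 * t) 1; pose d (t : R) := Num.max 0 (2 * t - 1).
pose gam' t := gam (c t) + (d t)%:C%C *: (X' - X).
have cdl t : t <= 2^-1 -> c t = 2 * t /\ d t = 0.
  by move=> t2; split; [apply/min_idPl|apply/max_idPl]; lra.
have cdr t : 2^-1 <= t -> c t = 1 /\ d t = 2 * t - 1.
  by move=> t2; split; [apply/min_idPr|apply/max_idPr]; lra.
have c01 t : 0 <= t <= 1 -> 0 <= c t <= 1.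
  by move=> /andP[t0 t1]; rewrite le_min ge_min lexx orbT ler01 andbT mulr_ge0.
(* The Lipschitz constant 2 is the reason for the radii [e / 2] below. *)
have c_lip s t : `|c s - c t| <= 2 * `|s - t|.
  have := ler_norm (s - t); have := ler_norm (t - s); rewrite distrC ler_norml.
  have [s2|/ltW s2] := leP s 2^-1; have [t2|/ltW t2] := leP t 2^-1.
  - by rewrite (cdl s s2).1 (cdl t t2).1; lra.
  - by rewrite (cdl s s2).1 (cdr t t2).1; lra.
  - by rewrite (cdr s s2).1 (cdl t t2).1; lra.
  - by rewrite (cdr s s2).1 (cdr t t2).1; lra.
have gaml t : t <= 2^-1 -> gam' t = gam (c t).
  by move=> /cdl[_ d0]; rewrite /gam' d0 scale0r addr0.
have gamr t : 2^-1 <= t -> gam' t = X + (2 * t - 1)%:C%C *: (X' - X).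
  by move=> /cdr[c1 dE]; rewrite /gam' c1 dE g1.
have UD t : 0 <= t <= 1 -> U (c t) (gam' t) /\ D n (gam' t).
  move=> t01; have [t2|/ltW t2] := leP t 2^-1.
    rewrite gaml //; have [_ Uc _] := an (c t) (introT idP (c01 t t01)).
    by split => //; apply: Dg; rewrite in_itv; exact: c01.
  rewrite gamr //; have [-> _] := cdr t t2; apply: segW; lra.
have half0 : (0 : R) <= 2^-1 by rewrite invr_ge0.
have half1 : (2^-1 : R) <= 1 by lra.
have c0 : c 0 = 0 by rewrite (cdl 0 half0).1 mulr0.
have gam'0 : gam' 0 = gam 0 by rewrite gaml // c0.
exists gam', (U \o c), (h \o c); split.
- split=> [|t]; last by rewrite in_itv => /UD[].
  apply/subspace_continuousP => t t01; apply: tvs_cvgD; last apply: tvs_cvgZ.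
  + suff : {within `[0, 1], continuous (gam \o c)}.
      by move=> /subspace_continuousP; exact.
    apply/path_continuousP => {t01}t t01 N tN.
    move/path_continuousP : cg => cg.
    have [e e0 eN] := cg (c t) (c01 t t01) N tN.
    exists (e / 2); first by rewrite divr_gt0.
    move=> s s01 st; apply: eN; first exact: c01.
    by apply: le_lt_trans (c_lip s t) _; rewrite mulrC -ltr_pdivlMr.
  + apply: cvg_within_filter.
    have dc : continuous (fun u : R => 2 * u - 1).
      move=> u; apply: cvgB; last exact: cvg_cst.
      by apply: cvgM; [exact: cvg_cst|exact: cvg_id].
    have dt : d @ t --> d t.
      exact: (@continuous_max R R (fun=> 0) _ t (@cst_continuous _ _ 0 t) (dc t)).
    exact: cvg_comp _ _ dt (@real_complex_continuous R (d t)).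
  + exact: cvg_cst.
- by rewrite gam'0.
- by rewrite gamr // mulr1 addrK scale1r subrKC.
- split=> [t t01| |t t01].
  + rewrite in_itv in t01; have [Ut _] := UD t t01.
    by have [oU _ ant] := an (c t) (introT idP (c01 t t01)).
  + by rewrite /= c0 gam'0.
  rewrite in_itv in t01; have [e e0 et] := loc (c t) (introT idP (c01 t t01)).
  have close s : 0 <= s <= 1 -> `|s - t| < e / 2 -> s <= 2^-1 ->
      U (c t) (gam' s) /\ \forall x \near gam' s, h (c s) x = h (c t) x.
    move=> s01 st s2; rewrite gaml //; apply: et; first exact: c01.
    by apply: le_lt_trans (c_lip s t) _; rewrite mulrC -ltr_pdivlMr.
  (* Before time 1/2 the radius is cut so that s stays on [gam]. From 1/2 on, [c t] is 1, and times
     s beyond 1/2 use the same element [h 1]. *)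
  have [t2|t2] := ltP t 2^-1.
    exists (Num.min (e / 2) (2^-1 - t)); first by rewrite lt_min divr_gt0 //= subr_gt0.
    move=> s; rewrite in_itv lt_min => s01 /andP[st st2]; apply: close => //.
    by move: st2; rewrite ltr_norml => /andP[_]; rewrite ltrBlDr subrK => /ltW.
  exists (e / 2); first by rewrite divr_gt0.
  move=> s; rewrite in_itv => s01 st.
  have [s2|/ltW s2] := leP s 2^-1; first exact: close.
  have [cs _] := cdr s s2; have [ct _] := cdr t t2.
  have [Us _] := UD s s01; rewrite /= ct -[in U 1]cs; split => //.
  by rewrite cs; apply: (@filterE _ _ (@nbhs_filter _ (gam' s))).
- by rewrite /= (cdr 1 half1).1.
Qed.

(* [B n] may be empty although [D n] is not: the value at [X] is then read off
   from a corner of the value at [X (+) W], at a level that [B] meets. *)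
Lemma complement_exists n : (exists m, B m !=set0) -> D n !=set0 ->
  exists kW : {k : nat & mxlevel R1 k},
    D (tag kW) (tagged kW) /\ B (n + tag kW)%N !=set0.
Proof.
move=> [m [X0 BX0]] [X DX]; have [D0 Dsum _] := D_free; have [B0 Bsum _] := B_free.
have Dmul j : exists Z, D (j.+1 * n)%N Z.
  elim: j => [|j [Z DZ]]; first by rewrite mul1n; exists X.
  by exists (dsum X Z); exact: Dsum.
have Bmul j : exists Z, B (j.+1 * m)%N Z.
  elim: j => [|j [Z BZ]]; first by rewrite mul1n; exists X0.
  by exists (dsum X0 Z); exact: Bsum.
case: m X0 BX0 Bmul => [X0|m X0 _ Bmul]; first by rewrite B0.
case: n X DX Dmul => [X|n X _ Dmul]; first by rewrite D0.
(* With N and M the two positive levels, [Z] has level (2M - 1)N, so X (+) Z has level 2NM, a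
   multiple of M. The factor 2 keeps the level of [Z] positive, as [D 0] is empty. *)
have [Z DZ] := Dmul (m + m)%N; have [Y BY] := Bmul (n + n).+1.
exists (Tagged (mxlevel R1) Z); split=> //=.
have -> : (n.+1 + (m + m).+1 * n.+1 = (n + n).+2 * m.+1)%N by lia.
by exists Y.
Qed.

(** Padding [A] with zeros gives a partial isometry that intertwines X (+) W and Y (+) W' whatever
    the complements are. For A = 1 the corner is seen to depend on neither complement nor path. *)
Lemma end_element_corner n m k l (X : mxlevel R1 n) (Y : mxlevel R1 m)
    (W : mxlevel R1 k) (W' : mxlevel R1 l) g g' (A : 'M[R[i]]_(n, m)) :
  end_element (dsum X W) g -> end_element (dsum Y W') g' ->
  A *m A ^t* *m A = A ->
  lmx A Y = rmx X A -> lmx (A ^t* ) X = rmx Y (A ^t* ) ->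
  lmx A (ulblock (g' (dsum Y W'))) = rmx (ulblock (g (dsum X W))) A.
Proof.
move=> Xg Yg' AAA AY AX.
have T_adj : (block_mx A 0 0 0 : 'M[R[i]]_(n + k, m + l)) ^t* =
    block_mx (A ^t* ) 0 0 0.
  by rewrite trmxC_block !trmx0 !map_mx0.
have := end_element_intertwine (T := block_mx A 0 0 0) Xg Yg'.
rewrite T_adj /dsum !mulmx_block !lmx_block !rmx_block.
rewrite !(mul0mx, mulmx0, lmx0, lmx0r, rmx0, rmx0l, addr0) AAA AY AX.
move=> /(_ erefl erefl erefl).
rewrite -[X in lmx _ X]submxK -[X in rmx X _]submxK lmx_block rmx_block.
by rewrite !(lmx0, rmx0, addr0) => /eq_block_mx[].
Qed.

(** The complement depends on the level alone, so that X |-> X (+) W is one affine map on the whole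
    of [D n]. *)
Definition corner_extension (kW : nat -> {k : nat & mxlevel R1 k}) n
    (X : mxlevel R1 n) (Y : mxlevel R2 n) :=
  exists2 g, end_element (dsum X (tagged (kW n))) g &
    Y = ulblock (g (dsum X (tagged (kW n)))).

Lemma extension_exists : (exists m, B m !=set0) ->
  exists g : forall n, mxlevel R1 n -> mxlevel R2 n,
    free_analytic D g /\ (forall n X, B n X -> g n X = f n X).
Proof.
move=> Bne; have [_ Dsum Duni] := D_free; have [_ Bsum _] := B_free.
have kWex n : exists kW : {k : nat & mxlevel R1 k}, D n !=set0 ->
    D (tag kW) (tagged kW) /\ B (n + tag kW)%N !=set0.
  have [Dn|Dn] := pselect (D n !=set0).
    by have [kW kWP] := complement_exists Bne Dn; exists kW.
  (* A dummy complement for the levels where [D] is empty. *)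
  by exists (Tagged (mxlevel R1) (0 : mxlevel R1 0)).
pose kW n := sval (cid (kWex n)).
have kWP n := svalP (cid (kWex n)); rewrite -/(kW _) in kWP.
have ex n (X : mxlevel R1 n) : exists Y, D n X -> corner_extension kW X Y.
  have [DX|nDX] := pselect (D n X); last by exists 0.
  have [DW BW] := kWP n (ex_intro _ X DX).
  have [g Xg] := end_element_exists BW (Dsum _ _ _ _ DX DW).
  by exists (ulblock (g (dsum X (tagged (kW n))))) => _; exists g.
pose g n X := sval (cid (ex n X)).
have gP n X : D n X -> corner_extension kW X (g n X) := svalP (cid (ex n X)).
(* Both rules of a free function come from this relation: [A] unitary gives conjugation, and [A] the
   inclusion of a summand gives direct sums. *)
have g_intertwine n m (X : mxlevel R1 n) (Y : mxlevel R1 m) (A : 'M[R[i]]_(n, m)) :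
    D n X -> D m Y -> A *m A ^t* *m A = A ->
    lmx A Y = rmx X A -> lmx (A ^t* ) X = rmx Y (A ^t* ) ->
    lmx A (g m Y) = rmx (g n X) A.
  by move=> /gP[h Xh ->] /gP[h' Yh' ->]; exact: end_element_corner.
exists g; split; last first.
  move=> n X BX; have [h Xh ->] := gP n X (BD BX).
  (* X (+) X lies in [B], where [f] itself is an end element with corner [f n X]; the corner lemma
     with A = 1 compares it with the chosen one. *)
  have Xf := end_element_base (Bsum _ _ _ _ BX BX).
  have := end_element_corner (A := 1%:M) Xh Xf.
  rewrite trmx1 map_mx1 !mul1mx !lmx1 !rmx1 => <- //.
  have [[fsum _] _] := f_an.
  by rewrite fsum // ulblock_dsum.
split; last first.
  move=> n X DX; have [h Xh _] := gP n X DX.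
  have dsumW : (fun Z : mxlevel R1 n => dsum Z (tagged (kW n))) @ X -->
      dsum X (tagged (kW n)).
    by apply: (dsum_cvg (@nbhs_filter _ X)); [exact: cvg_id|exact: cvg_cst].
  have near_h : \forall Z \near X, end_element (dsum Z (tagged (kW n))) h.
    exact: dsumW _ (end_element_near Xh).
  have near_D : nbhs X (D n) by apply: open_nbhs_nbhs; split => //; exact: D_open.
  (* Near [X] the one element [h] serves all the points Z (+) W, so uniqueness of end values makes
     [g n] the corner of [h] there, although [g] was chosen pointwise. *)
  apply: (@analytic_at_near _ _ _
      (@ulblock _ R2 n (tag (kW n)) \o h \o
       (fun Z : mxlevel R1 n => dsum Z (tagged (kW n))))).
    apply: filterS2 near_h near_D => Z Zh /gP[h' Zh' ->] /=.
    by rewrite (end_element_unique Zh Zh').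
  apply: (analytic_at_comp _ (dsum0r_cont_linear R1 n (tag (kW n)))
    (ulblock_cont_linear R2 n (tag (kW n)))); last exact: end_element_analytic.
  by move=> Z Z'; rewrite -dsumD addr0.
split=> [n m X Y DX DY|n V X uV DX]; last first.
  have VV : V *m V ^t* = 1%:M by exact/unitarymxP.
  have VV' := mulmx1C VV.
  (* [V] intertwines [uconj V X] and [X]. *)
  have gV : lmx V (g n (uconj V X)) = rmx (g n X) V.
    apply: g_intertwine => //; first exact: Duni.
    - by rewrite VV mul1mx.
    - by rewrite uconjE lrmxA lmxA VV lmx1.
    - by rewrite uconjE rmxA VV rmx1.
  by rewrite [RHS]uconjE lrmxA -gV lmxA VV' lmx1.
have dsumEh E (Z : mxlevel E n) (Z' : mxlevel E m) :
  dsum Z Z' = row_mx (col_mx Z 0) (col_mx 0 Z') by rewrite -block_mxEh.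
have dsumEv E (Z : mxlevel E n) (Z' : mxlevel E m) :
  dsum Z Z' = col_mx (row_mx Z 0) (row_mx 0 Z') by rewrite -block_mxEv.
have DXY := Dsum _ _ _ _ DX DY.
(* The inclusion of the first summand intertwines [X] with X (+) Y, which determines the first n
   columns of the value; the second summand gives the others. *)
have left : col_mx (g n X) 0 = lsubmx (g (n + m)%N (dsum X Y)).
  have adj : (col_mx 1%:M 0 : 'M[R[i]]_(n + m, n)) ^t* = row_mx 1%:M 0.
    by rewrite tr_col_mx map_row_mx trmx1 map_mx1 trmx0 map_mx0.
  have := g_intertwine _ _ (dsum X Y) X (col_mx 1%:M 0) DXY DX.
  rewrite adj -mulmxA mul_row_col mulmx0 mulmx1 addr0 mulmx1.
  rewrite [in rmx (dsum X Y) _]dsumEh rmx_row_col [in lmx _ (dsum X Y)]dsumEv.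
  rewrite lmx_row_col !lmx_col rmx_row !(lmx0, rmx0, lmx1, rmx1, addr0).
  move=> /(_ erefl erefl erefl) ->.
  by rewrite -[X in rmx X _]hsubmxK rmx_row_col rmx0 rmx1 addr0.
have right : col_mx 0 (g m Y) = rsubmx (g (n + m)%N (dsum X Y)).
  have adj : (col_mx 0 1%:M : 'M[R[i]]_(n + m, m)) ^t* = row_mx 0 1%:M.
    by rewrite tr_col_mx map_row_mx trmx1 map_mx1 trmx0 map_mx0.
  have := g_intertwine _ _ (dsum X Y) Y (col_mx 0 1%:M) DXY DY.
  rewrite adj -mulmxA mul_row_col mulmx0 mulmx1 add0r mulmx1.
  rewrite [in rmx (dsum X Y) _]dsumEh rmx_row_col [in lmx _ (dsum X Y)]dsumEv.
  rewrite lmx_row_col !lmx_col rmx_row !(lmx0, rmx0, lmx1, rmx1, add0r).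
  move=> /(_ erefl erefl erefl) ->.
  by rewrite -[X in rmx X _]hsubmxK rmx_row_col rmx0 rmx1 add0r.
by rewrite [RHS]dsumEh left right hsubmxK.
Qed.

End Monodromy.

Theorem theorem1p3 (R : realType) (R1 R2 : topologicalLmodType R[i])
    (hR2 : hausdorff_space R2)
    (D : forall n, set (mxlevel R1 n))
    (D_free : free_set D) (D_open : free_open D) (D_conn : free_connected D)
    (B : forall n, set (mxlevel R1 n))
    (B_free : free_set B) (B_open : free_open B) (B_conn : free_connected B)
    (B_nonempty : exists n, B n !=set0) (BD : forall n, B n `<=` D n)
    (f : forall n, mxlevel R1 n -> mxlevel R2 n) (f_an : free_analytic B f) :
  (exists g : forall n, mxlevel R1 n -> mxlevel R2 n,
      free_analytic D g /\ (forall n X, B n X -> g n X = f n X))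
  <->
  (forall n (gamma : R -> mxlevel R1 n),
      path_in (D n) gamma -> B n (gamma 0) -> continues_along (f n) gamma).
Proof.
split=> [[g [[_ an] gf]] n gamma [_ Dgamma] Bgamma|f_cont]; last first.
  exact: (extension_exists hR2 D_free D_open D_conn B_free B_open BD f_an).
(* A global extension continues [f] along any path with the same function element at all times. *)
exists (fun=> D n), (fun=> g n); split=> [t t01| |t _].
- by split; [exact: D_open|exact: Dgamma|exact: an].
- have : nbhs (gamma 0) (B n) by apply: open_nbhs_nbhs; split; [exact: B_open|].
  by apply: filterS => X; exact: gf.
- exists 1 => // s s01 _; split; first exact: Dgamma.
  by apply: (@filterE _ _ (@nbhs_filter _ (gamma s))).
Qed.
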